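(* (a) Let $G$ be an abelian cyclically ordered group. There exists an infinite c-archimedean cyclically ordered group which is elementarily equivalent to $G$ if and only if $G$ is c-regular and dense. (b) Any two dense c-regular cyclically ordered abelian groups are elementarily equivalent (in the language of cyclically ordered groups) if and only if their torsion subgroups are isomorphic and they have the same family of prime invariants of Zakon.
   Context: All groups are abelian, written additively. A cyclically ordered group $(G,R)$ is an abelian group $G$ with a ternary relation $R$ such that: $R(a,b,c)$ implies that $a,b,c$ are pairwise distinct; $R(a,b,c)\Rightarrow R(b,c,a)$; for every $c\in G$, $R(c,\cdot,\cdot)$ is a strict linear order on $G\setminus\{c\}$; $R(a,b,c)\Rightarrow R(a+u,b+u,c+u)$. The language of cyclically ordered groups is the language of groups together with the predicate $R$. $G$ is dense if it is nontrivial and for all $a\ne b$ in $G$ there is $c$ with $R(a,c,b)$. $\mathbb{K}$ is the group of complex numbers of modulus $1$, cyclically ordered by: for $0\le\theta_1,\theta_2,\theta_3<2\pi$, $R(e^{i\theta_1},e^{i\theta_2},e^{i\theta_3})$ iff $\theta_1<\theta_2<\theta_3$ up to cyclic permutation of the indices. A cyclically ordered group is c-archimedean if it is isomorphic, as a cyclically ordered group, to a subgroup of $\mathbb{K}$. $R(x_1,\dots,x_m)$ (with $m\ge3$) means that $R(x_i,x_j,x_k)$ holds for all $1\le i<j<k\le m$. For $n\ge2$, $(G,R)$ is c-$n$-regular if for all $x_1,\dots,x_n\in G$ with $R(0,x_1,\dots,x_n)$ there is $x\in G$ such that ($nx=x_1$ or $nx=x_n$ or $R(x_1,nx,x_n)$)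 and $R(0,x,\dots,(n-1)x,x_n)$. $G$ is c-regular if it is c-$n$-regular for every $n\ge2$. For an abelian group $A$ and a prime $p$, the $p$-th prime invariant of Zakon $[p]A$ is the maximum number of pairwise $p$-incongruent elements of $A$, i.e. the cardinality of $A/pA$ if finite, and $[p]A=\infty$ otherwise (infinite cardinals are not distinguished). The family of prime invariants of Zakon of $A$ is $([p]A)_{p\text{ prime}}$. *)

(* Defs.v *)
From HB Require Import structures.
From mathcomp Require Export all_boot all_order all_algebra.
From mathcomp Require Export all_classical all_reals trigo.
From mathcomp Require Export complex.

Set Implicit Arguments.
Unset Strict Implicit.
Unset Printing Implicit Defensive.

Import Order.TTheory GRing.Theory Num.Theory.

Local Open Scope classical_set_scope.
Local Open Scope ring_scope.

Definition strict_linear_order_on (T : Type) (D : set T)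
    (lt : T -> T -> Prop) : Prop :=
  [/\ forall x, D x -> ~ lt x x,
      forall x y z, D x -> D y -> D z -> lt x y -> lt y z -> lt x z
    & forall x y, D x -> D y -> [\/ lt x y, x = y | lt y x]].

Record cyclic_order (G : zmodType) (cyc : G -> G -> G -> Prop) : Prop :=
  CyclicOrder {
    cyc_distinct : forall a b c, cyc a b c -> [/\ a <> b, b <> c & c <> a];
    cyc_rot : forall a b c, cyc a b c -> cyc b c a;
    cyc_linear : forall c, strict_linear_order_on [set~ c] (cyc c);
    cyc_translate : forall a b c u, cyc a b c -> cyc (a + u) (b + u) (c + u)
  }.

Record coGroup := CoGroup {
  coGroup_sort :> zmodType;
  cyc : coGroup_sort -> coGroup_sort -> coGroup_sort -> Prop;
  cycP : cyclic_order cyc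
}.

Definition co_dense (G : coGroup) : Prop :=
  (exists x : G, x <> 0) /\
  (forall a b : G, a <> b -> exists c : G, cyc a c b).

(* Named variables: [TVar i] is the i-th variable and [FExists i] binds it. *)
Inductive co_term : Type :=
  | TVar of nat
  | TZero
  | TOpp of co_term
  | TAdd of co_term & co_term.

Inductive co_formula : Type :=
  | FEq of co_term & co_term
  | FCyc of co_term & co_term & co_term
  | FNot of co_formula
  | FAnd of co_formula & co_formula
  | FExists of nat & co_formula.

Fixpoint term_vars (t : co_term) : seq nat :=
  match t with
  | TVar i => [:: i]
  | TZero => [::]
  | TOpp t1 => term_vars t1
  | TAdd t1 t2 => term_vars t1 ++ term_vars t2
  end.

Fixpoint free_vars (f : co_formula) : seq nat :=
  match f with
  | FEq t1 t2 => term_vars t1 ++ term_vars t2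
  | FCyc t1 t2 t3 => term_vars t1 ++ term_vars t2 ++ term_vars t3
  | FNot f1 => free_vars f1
  | FAnd f1 f2 => free_vars f1 ++ free_vars f2
  | FExists i f1 => [seq j <- free_vars f1 | j != i]
  end.

Definition sentence (f : co_formula) : Prop := free_vars f = [::].

Fixpoint eval_term (G : coGroup) (e : nat -> G) (t : co_term) : G :=
  match t with
  | TVar i => e i
  | TZero => 0
  | TOpp t1 => - eval_term e t1
  | TAdd t1 t2 => eval_term e t1 + eval_term e t2
  end.

Fixpoint holds (G : coGroup) (e : nat -> G) (f : co_formula) : Prop :=
  match f with
  | FEq t1 t2 => eval_term e t1 = eval_term e t2
  | FCyc t1 t2 t3 => cyc (eval_term e t1) (eval_term e t2) (eval_term e t3)
  | FNot f1 => ~ holds e f1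
  | FAnd f1 f2 => holds e f1 /\ holds e f2
  | FExists i f1 => exists x : G, holds [eta e with i |-> x] f1
  end.

(* For a sentence the choice of the valuation is immaterial. *)
Definition models (G : coGroup) (f : co_formula) : Prop :=
  forall e : nat -> G, holds e f.

Definition elem_equiv (G H : coGroup) : Prop :=
  forall f, sentence f -> (models G f <-> models H f).

Definition unit_circle (R : realType) : set R[i] := [set z | `|z| = 1].

Definition expi (R : realType) (t : R) : R[i] := Complex (cos t) (sin t).

Definition circle_cyc (R : realType) (z1 z2 z3 : R[i]) : Prop :=
  exists t1 t2 t3 : R,
    [/\ 0 <= t1 < 2 * pi, 0 <= t2 < 2 * pi & 0 <= t3 < 2 * pi] /\
    [/\ z1 = expi t1, z2 = expi t2 & z3 = expi t3] /\
    [\/ t1 < t2 < t3, t2 < t3 < t1 | t3 < t1 < t2].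

Definition circle_subgroup (R : realType) (S : set R[i]) : Prop :=
  [/\ S `<=` @unit_circle R, S 1,
      forall z w, S z -> S w -> S (z * w)
    & forall z, S z -> S z^-1].

Definition c_archimedean (R : realType) (G : coGroup) : Prop :=
  exists (S : set R[i]) (f : G -> R[i]),
    [/\ circle_subgroup S,
        set_bij [set: G] S f,
        forall x y, f (x + y) = f x * f y
      & forall a b c, cyc a b c <-> circle_cyc (f a) (f b) (f c)].

Definition cyc_seq (G : coGroup) (s : seq G) : Prop :=
  forall i j k : nat, (i < j)%N -> (j < k)%N -> (k < size s)%N ->
    cyc s`_i s`_j s`_k.

(* The tuple [x] lists x_1, ..., x_n from index 0, so x_1 is [x`_0] and x_n is
   [x`_n.-1]; [mkseq (fun i => y *+ i) n] is 0, y, ..., (n-1)y. *)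
Definition c_n_regular (n : nat) (G : coGroup) : Prop :=
  forall x : n.-tuple G, cyc_seq (0 :: x) ->
    exists y : G,
      [\/ y *+ n = x`_0, y *+ n = x`_n.-1 | cyc x`_0 (y *+ n) x`_n.-1] /\
      cyc_seq (rcons (mkseq (fun i => y *+ i) n) x`_n.-1).

Definition c_regular (G : coGroup) : Prop :=
  forall n, (2 <= n)%N -> c_n_regular n G.

Definition torsion (A : zmodType) : set A :=
  [set x | exists2 n : nat, (0 < n)%N & x *+ n = 0].

(* Isomorphism of the torsion subgroups as groups; the values of [f] outside
   the torsion subgroup are irrelevant. *)
Definition torsion_isomorphic (A B : zmodType) : Prop :=
  exists f : A -> B,
    set_bij (@torsion A) (@torsion B) f /\
    (forall x y, torsion x -> torsion y -> f (x + y) = f x + f y).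

Definition congruent (A : zmodType) (p : nat) (x y : A) : Prop :=
  exists z : A, x - y = z *+ p.

Definition incongruent_family (A : zmodType) (p n : nat) : Prop :=
  exists u : 'I_n -> A, forall i j, i != j -> ~ congruent p (u i) (u j).

(* The largest size of a family of pairwise p-incongruent elements, and [None]
   (standing for infinity) when there is no largest size. *)
Definition zakon_invariant (A : zmodType) (p : nat) : option nat :=
  xget None [set o | exists n : nat,
    [/\ o = Some n, incongruent_family A p n
      & forall m, incongruent_family A p m -> (m <= n)%N]].

(* Main.v *)
From HB Require Import structures.
Require Import Defs.
From mathcomp Require Import ring lra zify lebesgue_measure.
Set Implicit Arguments.
Unset Strict Implicit.
Unset Printing Implicit Defensive.

Import Order.TTheory GRing.Theory Num.Theory.

Local Open Scope classical_set_scope.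
Local Open Scope ring_scope.

(* A cyclically ordered group G is unwound into an ordered group W with a
   positive cofinal element u such that G = W / Zu.  Then G is dense and c-regular
   iff nW is dense in the order of W for every n > 0.  For such W the theory of
   (W, u) is determined by the integers dividing u and by the dimensions of the
   spaces W / pW, via a back-and-forth argument: two tuples correspond when their
   bounded integer combinations have the same signs and when, modulo bounded
   powers of small primes, they have the same coordinates in F_p-independent
   families.  A new element is matched either by solving a linear equation, or by
   choosing its residues first and then, as nW is dense, an element with these
   residues in the prescribed interval.  The integers dividing u are the orders of
   the torsion elements of G, hence (b).

   An infinite subgroup of the circle unwinds to a dense archimedean group, where
   every nW is dense.  Conversely, a dense c-regular G has a countable pure
   subgroup with the same invariants whose unwinding embeds in the group R, as R
   has uncountable dimension over Q; the order induced by R differs from that of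
   G, but the invariants, hence the theory, are the same. *)

(** Inequalities cannot be added for the relation R of G, whereas integer combinations of elements
    of W have signs; this is the reason for unwinding. With variables lifted to [0, u[, a fixed term
    stays within a bounded multiple of u, so an atomic formula of G amounts to finitely many signs
    of integer combinations of the lifts and u, with coefficients bounded in terms of the formula.
    Each quantifier enlarges the bounds by a computable amount, which gives a finite game for every
    sentence. The dimension of W / pW is that of G / pG if p divides u and one more otherwise. This
    is how the divisors of u, that is the torsion of G, enter beside the invariants of Zakon.
    Infinite dimensions are handled without cardinals: the game involves finitely many independent
    elements at a time and only asks whether one more exists on the other side. *)

(* The trivial extension Z + W of Z by an abelian group W is a commutative ring
   containing W, so that [ring] proves the linear identities of W. *)
Definition triv_ext (W : zmodType) : Type := (int * W)%type.

Section TrivExt.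
Variable W : zmodType.
HB.instance Definition _ := GRing.Zmodule.copy (triv_ext W) (int * W)%type.
Implicit Types x y z : triv_ext W.

Definition te_one : triv_ext W := (1, 0).
Definition te_mul x y : triv_ext W := (x.1 * y.1, x.2 *~ y.1 + y.2 *~ x.1).

Lemma te_mulA : associative te_mul.
Proof.
move=> [a x] [b y] [c z]; rewrite /te_mul /=; congr (_, _); first exact: mulrA.
rewrite !mulrzDl -!mulrzA -addrA; congr (_ + (_ *~ _ + _ *~ _)); exact: mulrC.
Qed.

Lemma te_mulC : commutative te_mul.
Proof.
by move=> [a x] [b y]; rewrite /te_mul /= addrC; congr (_, _); rewrite mulrC.
Qed.

Lemma te_mul1 : left_id te_one te_mul.
Proof. by move=> [a x]; rewrite /te_mul /= mul1r mul0rz add0r mulr1z. Qed.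

Lemma te_mulDl : left_distributive te_mul +%R.
Proof.
move=> [a x] [b y] [c z]; rewrite /te_mul /=.
have -> : forall (u v : triv_ext W), u + v = (u.1 + v.1, u.2 + v.2) :> (int * W).
  by move=> [? ?] [? ?].
by rewrite /= mulrDl mulrzDl mulrzDr addrACA.
Qed.

Lemma te_one_neq0 : te_one != 0.
Proof. by apply/eqP => -[]. Qed.

HB.instance Definition _ := GRing.Zmodule_isComNzRing.Build (triv_ext W)
  te_mulA te_mulC te_mul1 te_mulDl te_one_neq0.

Definition te_inj (w : W) : triv_ext W := (0, w).

Lemma te_inj_additive : zmod_morphism te_inj.
Proof. by move=> x y; rewrite /te_inj; congr (_, _). Qed.

HB.instance Definition _ := GRing.isZmodMorphism.Build W (triv_ext W) te_inj
  te_inj_additive.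

Lemma te_injI (x y : W) : te_inj x = te_inj y -> x = y.
Proof. by case. Qed.
End TrivExt.

Ltac zring := apply: te_injI; ring.

(** * Ordered groups *)

Record ogroup := OGroup {
  ogroup_sort :> zmodType;
  opos : ogroup_sort -> Prop;
  oposD : forall x y, opos x -> opos y -> opos (x + y);
  opos0 : ~ opos 0;
  opos_total : forall x, [\/ opos x, x = 0 | opos (- x)]
}.

Section OrderedGroup.
Variable W : ogroup.
Implicit Types (x y z : W) (k l : int) (n : nat).

Definition olt x y := opos (y - x).
Definition ole x y := olt x y \/ x = y.

Lemma olt0 x : olt 0 x = opos x.
Proof. by rewrite /olt subr0. Qed.

Lemma olt_irr x : ~ olt x x.
Proof. by rewrite /olt subrr; exact: opos0. Qed.

Lemma olt_trans y x z : olt x y -> olt y z -> olt x z.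
Proof. by rewrite /olt => h1 h2; have := oposD h1 h2; congr opos; zring. Qed.

Lemma olt_asym x y : olt x y -> ~ olt y x.
Proof. by move=> h1 h2; apply: (@olt_irr x); exact: olt_trans h2. Qed.

Lemma olt_total x y : [\/ olt x y, x = y | olt y x].
Proof.
rewrite /olt; case: (opos_total (y - x)) => h; first exact: Or31.
- by apply: Or32; move/eqP: h; rewrite subr_eq0 => /eqP.
- by apply: Or33; rewrite opprB in h.
Qed.

Lemma oleNgt x y : ole x y <-> ~ olt y x.
Proof.
split=> [[h|->]|h]; [exact: olt_asym | exact: olt_irr |].
by case: (olt_total x y) => // g; [left|right].
Qed.

Lemma oltNge x y : olt x y <-> ~ ole y x.
Proof. by rewrite oleNgt; split=> [? //|/contrapT]. Qed.

Lemma ole_refl x : ole x x. Proof. by right. Qed.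
Hint Resolve ole_refl : core.

Lemma ole_lt_trans y x z : ole x y -> olt y z -> olt x z.
Proof. by case=> [|-> //]; exact: olt_trans. Qed.

Lemma olt_le_trans y x z : olt x y -> ole y z -> olt x z.
Proof. by move=> h [|<- //]; exact: olt_trans. Qed.

Lemma ole_trans y x z : ole x y -> ole y z -> ole x z.
Proof. by move=> h [g|<- //]; left; exact: ole_lt_trans g. Qed.

Lemma olt_add2r z x y : olt (x + z) (y + z) = olt x y.
Proof. by rewrite /olt; congr opos; zring. Qed.

Lemma ole_add2r z x y : ole (x + z) (y + z) <-> ole x y.
Proof. by rewrite /ole olt_add2r; split=> -[h|h]; auto; right;
  [exact: addIr h|rewrite h]. Qed.

Lemma olt_add2l z x y : olt (z + x) (z + y) = olt x y.
Proof. by rewrite ![z + _]addrC olt_add2r. Qed.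

Lemma ole_add2l z x y : ole (z + x) (z + y) <-> ole x y.
Proof. by rewrite ![z + _]addrC ole_add2r. Qed.

Lemma olt_add x y x' y' : olt x y -> olt x' y' -> olt (x + x') (y + y').
Proof. by rewrite /olt => h1 h2; have := oposD h1 h2; congr opos; zring. Qed.

Lemma opp_olt x y : olt (- x) (- y) = olt y x.
Proof. by rewrite /olt; congr opos; zring. Qed.

Lemma opos_mulrn n x : (0 < n)%N -> opos x -> opos (x *+ n).
Proof.
case: n => // n _ px; elim: n => [|n IH]; first by rewrite mulr1n.
by rewrite mulrS; exact: oposD.
Qed.

Lemma opos_mulrz k x : 0 < k -> opos (x *~ k) <-> opos x.
Proof.
case: k => [[|n]|] // _; split; last exact: opos_mulrn.
move=> h; case: (opos_total x) => // [x0|nx].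
  by move: h; rewrite x0 mul0rz => /opos0.
have := oposD h (opos_mulrn (ltn0Sn n) nx).
by rewrite mulNrn -pmulrn subrr => /opos0.
Qed.

Lemma opos_mulrzr k x : opos x -> opos (x *~ k) <-> 0 < k.
Proof.
move=> px; split=> [h|k0]; last exact/opos_mulrz.
rewrite ltNge; apply/negP => kn; have [k0|k0] := eqVneq k 0.
  by move: h; rewrite k0 mulr0z => /opos0.
have kp : 0 < - k by lia.
have := oposD h ((opos_mulrz x kp).2 px); rewrite -mulrzDr subrr mulr0z.
exact: opos0.
Qed.

Lemma olt_mulrz k x y : 0 < k -> olt (x *~ k) (y *~ k) <-> olt x y.
Proof. by move=> k0; rewrite /olt -mulrzBl; exact: opos_mulrz. Qed.

Lemma olt_mulrzr x k l : opos x -> olt (x *~ k) (x *~ l) <-> k < l.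
Proof. by move=> px; rewrite /olt -mulrzBr opos_mulrzr // subr_gt0. Qed.

Lemma otorsion_free k x : k != 0 -> x *~ k = 0 -> x = 0.
Proof.
move=> k0 xk; have [kp|kn|k00] := ltgtP 0 k; last by rewrite -k00 eqxx in k0.
  case: (opos_total x) => // px.
    by move/(opos_mulrz x kp): px; rewrite xk => /opos0.
  by move/(opos_mulrz _ kp): px; rewrite mulNrz xk oppr0 => /opos0.
have kp : 0 < - k by lia.
case: (opos_total x) => // px.
  by move/(opos_mulrz x kp): px; rewrite mulrNz xk oppr0 => /opos0.
by move/(opos_mulrz _ kp): px; rewrite mulrNz mulNrz opprK xk => /opos0.
Qed.

Lemma omulrzI k : k != 0 -> injective (fun x => x *~ k).
Proof.
move=> k0 x y /= /eqP; rewrite -subr_eq0 -mulrzBl => /eqP h.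
by apply/eqP; rewrite -subr_eq0; apply/eqP; exact: otorsion_free h.
Qed.

Lemma ole_max (s : seq W) : s <> [::] ->
  exists2 m, m \in s & forall x, x \in s -> ole x m.
Proof.
elim: s => // a s IH _; case: s IH => [|b s] IH.
  by exists a; rewrite ?inE // => x; rewrite inE => /eqP->; right.
have [//|m ms hm] := IH.
case: (EM (olt m a)) => [h|h].
  exists a; first by rewrite inE eqxx.
  move=> x; rewrite inE => /orP[/eqP->|/hm hx]; first by right.
  by left; exact: ole_lt_trans hx h.
exists m; first by rewrite inE ms orbT.
by move=> x; rewrite inE => /orP[/eqP->|/hm //]; apply/oleNgt.
Qed.
End OrderedGroup.
Arguments olt_trans {W} y x z.
Arguments ole_trans {W} y x z.
Arguments olt_le_trans {W} y x z.
Arguments ole_lt_trans {W} y x z.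
#[export] Hint Resolve ole_refl : core.

Lemma ole_min (W : ogroup) (s : seq W) : s <> [::] ->
  exists2 m, m \in s & forall x, x \in s -> ole m x.
Proof.
move=> s0; have [|m /mapP[m' m's ->] hm] := @ole_max W (map -%R s).
  by case: s s0.
exists m' => // x xs; apply/oleNgt => h.
by have /oleNgt := hm _ (map_f -%R xs); apply; rewrite opp_olt.
Qed.

(* For n = 1 this says that the order of W is dense. *)
Definition regular_dense (W : ogroup) := forall (n : nat) (x y : W),
  (0 < n)%N -> olt x y -> exists z, olt x (z *+ n) /\ olt (z *+ n) y.

(** The endpoints are the greatest element of [s1] and the least one of [s2]; the positive [u]
    supplies a missing endpoint when a list is empty. *)
Lemma gap_between (W : ogroup) (u : W) (s1 s2 : seq W) : opos u ->
  (forall x y, x \in s1 -> y \in s2 -> olt x y) ->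
  exists x y, [/\ olt x y, forall z, z \in s1 -> ole z x
                & forall z, z \in s2 -> ole y z].
Proof.
move=> pu; have u_lt (x : W) : olt x (x + u) by rewrite /olt addrAC subrr add0r.
have lt_u (x : W) : olt (x - u) x by rewrite /olt opprB addrC subrK.
case: (pselect (s1 = [::])) => [->|/ole_max [m1 m1s h1]];
  case: (pselect (s2 = [::])) => [->|/ole_min [m2 m2s h2]] h.
- by exists 0, (0 + u).
- by exists (m2 - u), m2.
- by exists m1, (m1 + u).
- by exists m1, m2; split => //; exact: h.
Qed.

(** * Unwinding a cyclically ordered group *)

(* The order of G starting at 0, with 0 as least element. *)
Definition lt0 (G : coGroup) (x y : G) := cyc 0 x y \/ (x = 0 /\ y <> 0).

Section CyclicOrder.
Variable G : coGroup.
Implicit Types a b c x y z : G.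

Lemma cyc_rotE a b c : cyc a b c <-> cyc b c a.
Proof. by split=> [|h];
  [exact: cyc_rot (cycP G) _ _ _|do 2 apply: (cyc_rot (cycP G))]. Qed.

Lemma cyc_addr u a b c : cyc (a + u) (b + u) (c + u) <-> cyc a b c.
Proof.
split; last exact: cyc_translate (cycP G) _ _ _ _.
by move/(cyc_translate (cycP G) (- u)); rewrite !addrK.
Qed.

Lemma cyc_neq a b c : cyc a b c -> [/\ a <> b, b <> c & c <> a].
Proof. exact: cyc_distinct (cycP G) _ _ _. Qed.

Lemma cyc_tr c x y z : cyc c x y -> cyc c y z -> cyc c x z.
Proof.
move=> h1 h2; have [n1 n2 n3] := cyc_neq h1; have [m1 m2 m3] := cyc_neq h2.
by have [_ tr _] := cyc_linear (cycP G) c; apply: tr h1 h2 => //=; exact: nesym.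
Qed.

Lemma cyc_asym c x y : cyc c x y -> ~ cyc c y x.
Proof. by move=> h1 h2; have [_ + _] := cyc_neq (cyc_tr h1 h2). Qed.

Lemma cyc_tot c x y : x <> c -> y <> c -> [\/ cyc c x y, x = y | cyc c y x].
Proof. by have [_ _] := cyc_linear (cycP G) c; exact. Qed.

Lemma lt0_irr x : ~ lt0 x x.
Proof. by case=> [/cyc_neq[]|[->]]. Qed.

Lemma lt0_trans y x z : lt0 x y -> lt0 y z -> lt0 x z.
Proof.
case=> [h1|[-> y0]] [h2|[yz z0]]; try by [].
- by left; exact: cyc_tr h2.
- by have [] := cyc_neq h1; rewrite yz.
- by right; split=> //; have [_ _] := cyc_neq h2.
Qed.

Lemma lt0_total x y : [\/ lt0 x y, x = y | lt0 y x].
Proof.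
have [->|x0] := pselect (x = 0); have [->|y0] := pselect (y = 0).
- exact: Or32.
- by apply: Or31; right.
- by apply: Or33; right.
- by have [h|h|h] := cyc_tot x0 y0; [apply: Or31; left|apply: Or32|apply: Or33; left].
Qed.

Lemma lt0_cyc a b c : lt0 a b -> lt0 b c -> cyc a b c.
Proof.
case=> [h1|[-> b0]] [h2|[bz c0]] //.
- by apply/cyc_rotE; apply: (@cyc_tr b c 0 a); apply/cyc_rotE => //; apply/cyc_rotE.
- by have [] := cyc_neq h1; rewrite bz.
Qed.

Lemma cyc_lt0 a b c : cyc a b c <->
  [\/ lt0 a b /\ lt0 b c, lt0 b c /\ lt0 c a | lt0 c a /\ lt0 a b].
Proof.
split=> [h|[[h1 h2]|[h1 h2]|[h1 h2]]]; last 1 first.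
- by apply/cyc_rotE/cyc_rotE; exact: lt0_cyc.
- have [n1 n2 n3] := cyc_neq h; have n := cyc_asym h.
  case: (lt0_total a b) => // ab; case: (lt0_total b c) => // bc;
    case: (lt0_total c a) => // ca; try (by constructor); case: n.
  all: by [exact: lt0_cyc | apply/cyc_rotE; exact: lt0_cyc
          | do 2 apply/cyc_rotE; exact: lt0_cyc].
Qed.

(* Finitely many elements can be replaced by integers, which opens the order
   goals about them to [lia]. *)
Lemma lt0_rank (s : seq G) : exists f : G -> nat,
  {in s &, forall x y, (lt0 x y <-> (f x < f y)%N) /\ (x = y <-> f x = f y)}.
Proof.
pose f x := count (fun y => `[< lt0 y x >]) s.
have mono x y : x \in s -> lt0 x y -> (f x < f y)%N.
  move=> xs xy; rewrite /f {f}.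
  have sub : subpred (fun z => `[< lt0 z x >]) (fun z => `[< lt0 z y >]).
    by move=> z /asboolP zx; apply/asboolP; exact: lt0_trans zx xy.
  elim: s xs => //= a s' IH; rewrite inE => /orP[/eqP<-|/IH h].
    by have := sub_count sub s'; case: asboolP => [/lt0_irr //|_];
      case: asboolP => // _; lia.
  case: asboolP => [/asboolP/sub-> //|_].
  by rewrite add0n; exact: ltn_addl.
exists f => x y xs ys; case: (lt0_total x y) => h.
- have fxy := mono _ _ xs h; have ne : x <> y by move=> e; rewrite e in h;
  exact: lt0_irr h.
  by split; split=> //; lia.
- by rewrite h ltnn; split; split=> // /lt0_irr.
- have fyx := mono _ _ ys h; have ne : x <> y by move=> e; rewrite e in h;
  exact: lt0_irr h.
  split; split=> //; try lia.
  by move=> xy; case: (@lt0_irr x); exact: lt0_trans h.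
Qed.

Lemma lt0_shift z x y : lt0 x y <->
  cyc z (x + z) (y + z) \/ (x + z = z /\ y + z <> z).
Proof.
have e (t : G) : t + z = z <-> t = 0.
  by split=> [/(canRL (addrK z))|->]; rewrite ?subrr ?add0r.
by rewrite /lt0 e e -(cyc_addr z 0) add0r.
Qed.

(* The carry of the addition of the representatives of x and y in [0, u[. *)
Definition carry x y : int := (`[< lt0 (x + y) x >] : nat)%:Z.

(** The cocycle identity: both sides count the turns completed by x + y + z. Translating the
    comparison of y + z with y by x turns all four carries into comparisons among x, x + y and x + y
    + z, which ranks reduce to arithmetic. *)
Lemma carry_assoc x y z :
  carry x y + carry (x + y) z = carry y z + carry x (y + z).
Proof.
rewrite /carry addrA; set Q := x + y; set S := Q + z.
have -> : lt0 (y + z) y = lt0 (S - x) (Q - x).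
  by rewrite /S /Q; congr lt0; zring.
have -> : lt0 (S - x) (Q - x) = (cyc x S Q \/ (S = x /\ Q <> x)).
  by apply/propext; rewrite (lt0_shift x) !subrK.
have -> : cyc x S Q = ((lt0 x S /\ lt0 S Q) \/ (lt0 S Q /\ lt0 Q x) \/
                      (lt0 Q x /\ lt0 x S)).
  by apply/propext; rewrite cyc_lt0; split; [case|case=> [|[]]]; by [left|right;
    left|right; right|constructor].
have [f hf] := lt0_rank [:: x; Q; S].
have mx : x \in [:: x; Q; S] by rewrite inE eqxx.
have mQ : Q \in [:: x; Q; S] by rewrite !inE eqxx orbT.
have mS : S \in [:: x; Q; S] by rewrite !inE eqxx !orbT.
have [h1 e1] := hf _ _ mQ mx; have [h2 e2] := hf _ _ mS mQ.
have [h3 e3] := hf _ _ mS mx; have [h5 _] := hf _ _ mx mS.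
rewrite (propext h1) (propext h2) (propext h3) (propext h5) (propext e1) (propext e3).
by do 4 case: asboolP => /=; lia.
Qed.

(** If -x came before -y, translations would give y < y - x < -x < -y < x - y < x < y in the order
    starting at 0. *)
Lemma cyc0N x y : cyc 0 x y -> cyc 0 (- y) (- x).
Proof.
have F (a b : G) : cyc 0 a b -> cyc 0 (- b) (a - b) /\ cyc 0 (b - a) (- a).
  move=> h; split.
    by have := (cyc_addr (- b) _ _ _).2 h; rewrite subrr add0r => /cyc_rotE/cyc_rotE.
  by have := (cyc_addr (- a) _ _ _).2 h; rewrite subrr add0r => /cyc_rotE.
move=> h; have [n1 n2 n3] := cyc_neq h.
have Nx : - x <> 0 by move=> /eqP; rewrite oppr_eq0 => /eqP/nesym.
have Ny : - y <> 0 by move=> /eqP; rewrite oppr_eq0 => /eqP.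
have [//|/oppr_inj/nesym //|g] := cyc_tot Ny Nx.
have [h1 h2] := F _ _ h; have [] := F _ _ g;
  rewrite !opprK [- y + x]addrC [- x + y]addrC.
move=> h3 h4; have := cyc_tr (cyc_tr h3 h2) (cyc_tr g (cyc_tr h1 (cyc_tr h4 h))).
by case/cyc_neq.
Qed.

(** Apart from degenerate cases, a carry of a and b means -a < b in the order starting at 0, which
    negation turns into -b < a. *)
Lemma carry_comm x y : carry x y = carry y x.
Proof.
suff h (a b : G) : lt0 (a + b) a -> lt0 (a + b) b.
  by rewrite /carry [y + x]addrC; congr (nat_of_bool _)%:Z; apply/asbool_equiv_eq;
    split; [|rewrite addrC]; move/h; rewrite // addrC.
case=> [/(cyc_addr (- a))|[ab a0]].
  rewrite add0r subrr addrAC subrr add0r cyc_rotE cyc_rotE => /cyc0N.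
  by rewrite opprK -(cyc_addr b) add0r addNr cyc_rotE; left.
by right; split=> // b0; rewrite b0 addr0 in ab.
Qed.

Lemma carry0 x : carry 0 x = 0.
Proof. by rewrite /carry; case: asboolP => // -[/cyc_neq[]|[]]. Qed.

Lemma carryN x : carry x (- x) = (x != 0).
Proof.
rewrite /carry subrr; case: eqVneq => [->|/eqP x0]; case: asboolP => //.
  by move/lt0_irr.
by case; right.
Qed.
End CyclicOrder.

(** The pair (k, x) stands for k full turns plus the representative of x in the first turn. This is
    the extension of G by the integers with cocycle [carry], known as Rieger's unwinding. *)
Definition unwound (G : coGroup) : Type := (int * G)%type.

Section Unwound.
Variable G : coGroup.
HB.instance Definition _ := Choice.copy (unwound G) (int * G)%type.
Implicit Types v w : unwound G.

Definition unwound0 : unwound G := (0, 0).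
Definition unwoundN v : unwound G := (- v.1 - (v.2 != 0 : nat)%:Z, - v.2).
Definition unwoundD v w : unwound G := (v.1 + w.1 + carry v.2 w.2, v.2 + w.2).

Lemma unwoundDA : associative unwoundD.
Proof.
move=> [k x] [l y] [m z]; rewrite /unwoundD /=; congr (_, _); last exact: addrA.
by have := carry_assoc x y z; lia.
Qed.

Lemma unwoundDC : commutative unwoundD.
Proof.
by move=> [k x] [l y]; rewrite /unwoundD /= carry_comm [y + x]addrC [l + k]addrC.
Qed.

Lemma unwound0D : left_id unwound0 unwoundD.
Proof. by move=> [k x]; rewrite /unwoundD /= carry0 !add0r addr0. Qed.

Lemma unwoundND : left_inverse unwound0 unwoundN unwoundD.
Proof.
move=> [k x]; rewrite /unwoundD /unwoundN /= addNr carry_comm carryN.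
by congr (_, _); lia.
Qed.

HB.instance Definition _ := GRing.isZmodule.Build (unwound G)
  unwoundDA unwoundDC unwound0D unwoundND.

Definition unwound_pos w := 0 < w.1 \/ (w.1 = 0 /\ w.2 <> 0).

Lemma unwound_posD v w : unwound_pos v -> unwound_pos w -> unwound_pos (v + w).
Proof.
case: v w => [k x] [l y]; rewrite /unwound_pos /= /carry.
case=> [k0|[-> x0]] [l0|[-> y0]]; try (left; lia).
case: asboolP => h; [by left|right; split=> // xy; apply: h].
by rewrite xy; right.
Qed.

Lemma unwound_pos0 : ~ unwound_pos 0.
Proof. by case=> [|[]]. Qed.

Lemma unwound_total w : [\/ unwound_pos w, w = 0 | unwound_pos (- w)].
Proof.
case: w => k x; rewrite /unwound_pos /=.
have [k0|k0|->] := ltgtP k 0.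
- apply: Or33; case: eqVneq => [->|/eqP x0] /=; first by left; lia.
  have [->|k1] := eqVneq k (-1); last by left; lia.
  by right; split=> // /eqP; rewrite oppr_eq0 => /eqP.
- by apply: Or31; left.
- have [->|/eqP x0] := eqVneq x 0; first exact: Or32.
  by apply: Or31; right.
Qed.

Definition unwound_ogroup := OGroup unwound_posD unwound_pos0 unwound_total.
End Unwound.

(* G as the quotient of an ordered group W by the subgroup generated by a
   positive cofinal element u, with its cyclic order induced by [0, u[. *)
Record unwinding (G : coGroup) := Unwinding {
  uw :> ogroup;
  uu : uw;
  upr : {additive uw -> G};
  uu_pos : opos uu;
  upr_lift : forall g, exists w, [/\ upr w = g, ole 0 w & olt w uu];
  upr_ker : forall w, upr w = 0 -> exists k, w = uu *~ k;
  upr_uu : upr uu = 0;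
  upr_cyc : forall x y z, ole 0 x -> olt x uu -> ole 0 y -> olt y uu ->
    ole 0 z -> olt z uu -> (cyc (upr x) (upr y) (upr z) <->
    [\/ olt x y /\ olt y z, olt y z /\ olt z x | olt z x /\ olt x y])
}.
Arguments uu {G} u.
Arguments upr {G} u.

Section UnwindingExists.
Variable G : coGroup.
Let W := unwound_ogroup G.

Definition unwound_pr (w : W) : G := w.2.

Lemma unwound_pr_additive : zmod_morphism unwound_pr.
Proof. by []. Qed.

HB.instance Definition _ := GRing.isZmodMorphism.Build W G unwound_pr
  unwound_pr_additive.

Definition unwound_u : W := (1, 0).

Lemma unwound_uM k : unwound_u *~ k = (k, 0) :> W.
Proof.
have h n : unwound_u *+ n = (n%:Z, 0) :> W.
  elim: n => [|n IH]; first by rewrite mulr0n.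
  rewrite mulrS IH; change ((1 + n%:Z + carry (0 : G) 0, (0 : G) + 0) = (n.+1%:Z, 0)
    :> W).
  by rewrite carry0 !addr0; congr (_, _); lia.
case: k => n; first exact: h.
rewrite NegzE mulrNz -pmulrn h.
change ((- n.+1%:Z - ((0 : G) != 0 : nat)%:Z, - (0 : G)) = (- n.+1%:Z, 0) :> W).
by rewrite eqxx; congr (_, _); [rewrite /=; lia|exact: oppr0].
Qed.

Lemma unwound_lt (x y : G) : olt (W := W) (0, x) (0, y) <-> lt0 x y.
Proof.
have e : ((0, y) : W) - ((0, x) : W) = (- carry x (y - x), y - x) :> W.
  apply/eqP; rewrite subr_eq; apply/eqP.
  change (((0, y) : W) = (- carry x (y - x) + 0 + carry (y - x) x, y - x + x)).
  by rewrite subrK carry_comm; congr (_, _); lia.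
rewrite /olt e; rewrite /opos /= /unwound_pos /= /carry [x + _]addrC subrK.
have nxy : y - x <> 0 <-> y <> x.
  by split=> h e'; apply: h; [rewrite e' subrr|move/eqP: e'; rewrite subr_eq0 => /eqP].
have [f hf] := lt0_rank [:: x; y].
have mx : x \in [:: x; y] by rewrite inE eqxx.
have my : y \in [:: x; y] by rewrite !inE eqxx orbT.
have [h1 _] := hf _ _ mx my; have [h2 e2] := hf _ _ my mx.
by rewrite nxy (propext h1) (propext h2) (propext e2); case: asboolP => /=; lia.
Qed.

Lemma unwound_fund (w : W) : ole 0 w -> olt w unwound_u -> w = (0, w.2).
Proof.
case: w => k x w0; rewrite /olt /= => h.
suff -> : k = 0 by [].
have {w0}k0 : 0 <= k.
  case: w0 => [|[<- _] //]; by rewrite olt0 => -[/ltW|[/= -> _]].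
move: h; rewrite /opos /= /unwound_pos /= carry0; case: eqVneq => /= [->|_] [|[? h]];
  try lia.
by case: h; rewrite subrr.
Qed.

Definition unwound_unwinding : unwinding G.
Proof.
apply: (@Unwinding G W unwound_u unwound_pr) => [|g|[k x] /= x0||x y z x0 xu y0 yu z0
  zu].
- by left.
- exists (0, g); split=> //.
    by have [->|g0] := eqVneq g 0; [right|left; apply/unwound_lt; right; split=> //;
      apply/eqP].
  rewrite /olt /opos /= /unwound_pos /= carry0 add0r.
  case: eqVneq => [->|/eqP g0] /=; first by left.
  by right; split=> // /eqP; rewrite sub0r oppr_eq0 => /eqP.
- by exists k; rewrite unwound_uM; congr (_, _).
- by [].
- rewrite (unwound_fund x0 xu) (unwound_fund y0 yu) (unwound_fund z0 zu).
  have e (a b : G) := propext (unwound_lt a b).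
  by rewrite cyc_lt0 !e.
Qed.
End UnwindingExists.

(** * Regularity *)

Section Lift.
Variables (G : coGroup) (U : unwinding G).
Implicit Types (x y z : G) (v w : U).

Definition ulift x : U := projT1 (cid (upr_lift U x)).

Lemma uliftK x : upr U (ulift x) = x.
Proof. by rewrite /ulift; case: cid => w []. Qed.

Lemma ulift_ge0 x : ole 0 (ulift x).
Proof. by rewrite /ulift; case: cid => w []. Qed.

Lemma ulift_lt x : olt (ulift x) (uu U).
Proof. by rewrite /ulift; case: cid => w []. Qed.

Lemma upr_uM k : upr U (uu U *~ k) = 0.
Proof. by rewrite raddfMz upr_uu mul0rz. Qed.

Lemma upr_eq v w : upr U v = upr U w -> exists k, v = w + uu U *~ k.
Proof.
move=> e; have [|k hk] := @upr_ker _ U (v - w); first by rewrite raddfB e subrr.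
by exists k; rewrite -hk; zring.
Qed.

Lemma ufloor w : exists k, ole (uu U *~ k) w /\ olt w (uu U *~ (k + 1)).
Proof.
have [k] := upr_eq (esym (uliftK (upr U w))); have := ulift_lt (upr U w).
move: (ulift (upr U w)) (ulift_ge0 (upr U w)) => r r0 ru hk; exists k.
rewrite hk mulrzDr mulr1z -[X in ole X _]add0r ole_add2r; split=> //.
by rewrite [_ + uu U]addrC olt_add2r.
Qed.

Lemma upr_inj v w : ole 0 v -> olt v (uu U) -> ole 0 w -> olt w (uu U) ->
  upr U v = upr U w -> v = w.
Proof.
move=> v0 vu w0 wu /upr_eq [k hk]; rewrite hk in v0 vu *.
suff -> : k = 0 by rewrite mulr0z addr0.
have up := uu_pos U; have k1 : k < 1.
  apply/(olt_mulrzr k 1 up); rewrite mulr1z; apply: ole_lt_trans vu.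
  by rewrite -[X in ole X _]add0r ole_add2r.
have k2 : -1 < k.
  apply/(olt_mulrzr (-1) k up); rewrite mulrNz mulr1z -(olt_add2r (uu U)) addNr.
  by apply: ole_lt_trans v0 _; rewrite [w + _]addrC olt_add2l.
lia.
Qed.

Lemma upr_ulift w : ole 0 w -> olt w (uu U) -> ulift (upr U w) = w.
Proof.
by move=> *; apply: upr_inj; rewrite ?uliftK //; [exact: ulift_ge0|exact: ulift_lt].
Qed.

Lemma ulift0 : ulift 0 = 0.
Proof. by rewrite -(raddf0 (upr U)) upr_ulift //; rewrite olt0; exact: uu_pos. Qed.

Lemma ulift_gt0 x : x <> 0 -> olt 0 (ulift x).
Proof.
by move=> x0; case: (ulift_ge0 x) => // h; case: x0; rewrite -(uliftK x) -h raddf0.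
Qed.

Lemma cyc_ulift x y z : cyc x y z <->
  [\/ olt (ulift x) (ulift y) /\ olt (ulift y) (ulift z),
      olt (ulift y) (ulift z) /\ olt (ulift z) (ulift x)
    | olt (ulift z) (ulift x) /\ olt (ulift x) (ulift y)].
Proof.
rewrite -{1}(uliftK x) -{1}(uliftK y) -{1}(uliftK z).
by apply: upr_cyc; do ?[exact: ulift_ge0|exact: ulift_lt].
Qed.

Lemma cyc0_ulift x y : cyc 0 x y <-> x <> 0 /\ olt (ulift x) (ulift y).
Proof.
rewrite cyc_ulift ulift0; split=> [[[h1 h2]|[h1 h2]|[h1 h2]]|[x0 h]].
- by split=> // x0; move: h1; rewrite x0 ulift0 => /olt_irr.
- by have /oleNgt := ulift_ge0 y.
- by have /oleNgt := ulift_ge0 y.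
- by apply: Or31; split=> //; exact: ulift_gt0.
Qed.

Lemma cyc_seq_ulift (s : seq G) : cyc_seq (0 :: s) ->
  forall i j, (i < j)%N -> (j < size s)%N -> olt (ulift s`_i) (ulift s`_j).
Proof.
by move=> h i j ij js; have /cyc0_ulift [] := h 0%N i.+1 j.+1 isT ij js.
Qed.

Lemma cyc_seq_upr (s : seq G) (w : nat -> U) :
  (forall i, (i < size s)%N -> [/\ s`_i = upr U (w i), ole 0 (w i) & olt (w i) (uu
    U)]) ->
  (forall i j, (i < j)%N -> (j < size s)%N -> olt (w i) (w j)) -> cyc_seq s.
Proof.
move=> hw mono i j k ij jk ks; have js := ltn_trans jk ks; have is_ := ltn_trans ij js.
have [-> i0 iu] := hw _ is_; have [-> j0 ju] := hw _ js; have [-> k0 ku] := hw _ ks.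
by apply/upr_cyc => //; apply: Or31; split; exact: mono.
Qed.
End Lift.
Arguments ulift {G} U x.

Section Regular.
Variables (G : coGroup) (U : unwinding G).
Implicit Types (v w : U).
Let u := uu U.

Lemma regular_co_dense : regular_dense U -> co_dense G.
Proof.
move=> rd; have dens v w : olt v w -> exists z, olt v z /\ olt z w.
  by move=> /(rd 1%N _ _ isT) [z]; exists (z *+ 1).
split.
  have [z [z0 zu]] : exists z, olt 0 z /\ olt z u by apply: dens; rewrite olt0;
    exact: uu_pos.
  exists (upr U z) => h; have := upr_ulift (or_introl z0) zu.
  by rewrite h ulift0 => e; rewrite -e in z0; exact: olt_irr z0.
move=> a b ab; have [|z [z0 zb]] := dens 0 (ulift U (b - a)).
  by apply: ulift_gt0 => /eqP; rewrite subr_eq0 => /eqP/nesym.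
exists (upr U z + a); apply/(cyc_addr (- a)); rewrite addrK subrr.
have zu : olt z u by exact: olt_trans (ulift_lt U (b - a)).
apply/(cyc0_ulift U); rewrite upr_ulift //; last by left.
split=> // e; have := upr_ulift (or_introl z0) zu.
by rewrite e ulift0 => e'; rewrite -e' in z0; exact: olt_irr z0.
Qed.

Lemma opos_le_mulrn w m n : opos w -> (m < n)%N -> olt (w *+ m) (w *+ n).
Proof.
move=> pw mn; rewrite /olt -mulrnBr; last exact: ltnW.
by apply: opos_mulrn => //; rewrite subn_gt0.
Qed.

(** Choose w with n w strictly between the lifts of x_1 and x_n. Then 0, w, ..., (n-1) w and the
    lift of x_n increase inside [0, u[, so no multiple wraps around. *)
Lemma regular_c_regular : regular_dense U -> c_regular G.
Proof.
move=> rd n n2 x hx; have n0 : (0 < n)%N by lia.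
have sx : size x = n by exact: size_tuple.
have h1n : olt (ulift U x`_0) (ulift U x`_n.-1) by apply: cyc_seq_ulift hx _ _ _ _; lia.
have [w [h1 h2]] := rd n _ _ n0 h1n.
have wn0 : opos (w *+ n) by rewrite -olt0; apply: ole_lt_trans h1; exact: ulift_ge0.
have w0 : opos w by apply/(@opos_mulrz _ n); rewrite -?pmulrn //; lia.
have lt_n i : (i <= n)%N -> ole (w *+ i) (w *+ n).
  by rewrite leq_eqVlt => /orP[/eqP->|] //; left; exact: opos_le_mulrn.
have hi i : (i <= n)%N -> ole 0 (w *+ i) /\ olt (w *+ i) u.
  move=> ni; split; last by apply: ole_lt_trans (lt_n _ ni) (olt_trans _ _ _ h2
    (ulift_lt U _)).
  by case: i {ni} => [|i]; [right|left; rewrite olt0; exact: opos_mulrn].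
exists (upr U w); split.
  apply: Or33; rewrite -raddfMn; apply/(cyc_ulift U); rewrite upr_ulift;
    try exact: (hi n _).1; try exact: (hi n _).2.
  exact: Or31.
apply: (@cyc_seq_upr _ U _ (fun i => if (i < n)%N then w *+ i else ulift U x`_n.-1)).
  move=> i; rewrite size_rcons size_mkseq nth_rcons size_mkseq ltnS => ni.
  case: ifP => [lin|ltin]; first by rewrite nth_mkseq // raddfMn; have [] := hi i ni.
  have -> : i == n by lia.
  by rewrite uliftK; split=> //; [exact: ulift_ge0|exact: ulift_lt].
move=> i j ij; rewrite size_rcons size_mkseq ltnS => jn.
rewrite (leq_trans ij jn); case: ifP => _; first exact: opos_le_mulrn.
apply: ole_lt_trans h2; apply: lt_n; lia.
Qed.

Lemma dense_chain (W : ogroup) m (a b : W) :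
  (forall v w : W, olt v w -> exists z, olt v z /\ olt z w) -> olt a b ->
  exists e : nat -> W, [/\ e 0%N = a, e m.+1 = b
    & forall i, (i <= m)%N -> olt (e i) (e i.+1)].
Proof.
move=> dens; elim: m a => [|m IH] a ab.
  by exists (fun i => if i is 0%N then a else b); split=> // -[].
have [c [ac cb]] := dens _ _ ab; have [e [e0 em he]] := IH _ cb.
exists (fun i => if i is i'.+1 then e i' else a); split=> // -[_|i];
  first by rewrite e0.
exact: he.
Qed.

Lemma homo_olt (W : ogroup) m (e : nat -> W) :
  (forall i, (i <= m)%N -> olt (e i) (e i.+1)) ->
  forall i j, (i < j)%N -> (j <= m.+1)%N -> olt (e i) (e j).
Proof.
move=> he i j; elim: j => // j IH; rewrite ltnS leq_eqVlt => /orP[/eqP->|ij] jm.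
  exact: he.
by apply: olt_trans (IH ij (ltnW jm)) (he _ jm).
Qed.

Section Converse.
Hypotheses (Gdense : co_dense G) (Greg : c_regular G).

(** Translation reduces this to finding z in ]0, a[. Density of G gives one when a < u; otherwise
    the lift of any nonzero element lies below u, hence below a. *)
Lemma co_dense_order v w : olt v w -> exists z, olt v z /\ olt z w.
Proof.
suff h a : opos a -> exists z : U, olt 0 z /\ olt z a.
  move=> vw; have [z [z0 zw]] := h _ vw; exists (v + z).
  by rewrite -{1}[v]addr0 -[w](subrKC v) !olt_add2l.
rewrite -olt0 => a0; case: (EM (olt a u)) => [au|/oleNgt ua].
  have [|c] := Gdense.2 0 (upr U a); last first.
    by move/(cyc0_ulift U) => [c0]; rewrite upr_ulift //; [exists (ulift U c);
      split=> //; exact: ulift_gt0|left].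
  move=> e; have := upr_ulift (or_introl a0) au.
  by rewrite -e ulift0 => e'; rewrite -e' in a0; exact: olt_irr a0.
have [x /(ulift_gt0 U) x0] := Gdense.1.
by exists (ulift U x); split=> //; apply: olt_le_trans (ulift_lt U x) ua.
Qed.

(** c-regularity controls the class of n y, whereas n z is wanted for the lift z of y. A wrap before
    the n-th multiple is excluded by the monotonicity of the multiples of y, and one at the n-th by
    the choice of a and b. *)
Lemma c_regular_fund n v w : (1 < n)%N -> ole 0 v -> olt v w -> ole w u ->
  exists z, olt v (z *+ n) /\ olt (z *+ n) w.
Proof.
move=> n2 v0 vw wu.
have [b [vb bw]] := co_dense_order vw; have bu := olt_le_trans _ _ _ bw wu.
(* The condition b + b < u + a prevents n z from passing u: the class of n y would then lift to n z
   - u >= a, although n z < b + b. *)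
have [a [va ba ab]] : exists a, [/\ olt v a, olt (b + b) (u + a) & olt a b].
  have b2 : olt (b + b - u) b.
    by rewrite -[X in olt _ X](addrK u) /olt; move: bu; rewrite /olt; congr opos; zring.
  case: (EM (olt v (b + b - u))) => [h|/oleNgt h].
    have [a [h1 h2]] := co_dense_order b2; exists a; split=> //;
      first exact: olt_trans h1.
    by move: h1; rewrite /olt; congr opos; zring.
  have [a [h1 h2]] := co_dense_order vb; exists a; split=> //.
  by have := ole_lt_trans _ _ _ h h1; rewrite /olt; congr opos; zring.
(* c-regularity speaks of n-tuples, so a and b are completed to an increasing chain of n
   elements. *)
have [e [e0 en he]] := dense_chain (n - 2)%N co_dense_order ab.
have mono := homo_olt he; have n0 : ((n - 2).+1 = n.-1)%N by lia.
rewrite n0 in en mono.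
have ea i : (i < n)%N -> ole a (e i).
  case: i => [|i] hi; first by rewrite e0.
  by left; rewrite -e0; apply: mono => //; lia.
have eb i : (i < n)%N -> ole (e i) b.
  move=> hi; have [->|ne] := eqVneq i n.-1; first by rewrite en.
  by left; rewrite -en; apply: mono => //; lia.
have e_ge0 i : (i < n)%N -> olt 0 (e i).
  by move=> hi; apply: olt_le_trans (ea _ hi); exact: ole_lt_trans va.
have e_lt i : (i < n)%N -> olt (e i) u by move=> hi; apply: ole_lt_trans (eb _ hi) bu.
pose x := mktuple (fun i : 'I_n => upr U (e i)).
have xE i : (i < n)%N -> x`_i = upr U (e i).
  by move=> hi; have := tnth_mktuple (fun i : 'I_n => upr U (e i)) (Ordinal hi);
    rewrite (tnth_nth 0).
have sx : size x = n by exact: size_tuple.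
have [|y [hny hy]] := Greg n2 (x := x).
  apply: (@cyc_seq_upr _ U _ (fun i => if i is j.+1 then e j else 0)) => [[|i]|[|i]
    [|j]] //=.
  - by rewrite raddf0 olt0; split=> //; exact: uu_pos.
  - by rewrite ltnS sx => hi; rewrite xE //; split=> //; [left;
    exact: e_ge0|exact: e_lt].
  - by move=> _; rewrite ltnS sx; exact: e_ge0.
  - by rewrite ltnS sx => ij jn; apply: mono; lia.
set z := ulift U y.
have lx0 : ulift U x`_0 = a.
  have h0n : (0 < n)%N by lia.
  by rewrite xE // e0 upr_ulift //; [left; exact: ole_lt_trans va|exact: olt_trans bu].
have ln : (n.-1 < n)%N by lia.
have b0 : ole 0 b by left; rewrite -en; exact: e_ge0.
have lxn : ulift U x`_n.-1 = b by rewrite xE // upr_ulift ?en.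
have yi i : (0 < i)%N -> (i < n)%N -> y *+ i <> 0 /\ olt (ulift U (y *+ i)) b.
  move=> i0 hi; have := hy 0%N i n i0 hi;
    rewrite size_rcons size_mkseq => /(_ (leqnn _)).
  rewrite !nth_rcons size_mkseq (ltn_trans i0 hi) hi ltnn eqxx !nth_mkseq ?(ltn_trans
    i0 hi) //.
  by rewrite mulr0n => /(cyc0_ulift U); rewrite lxn.
have yij i j : (0 < i)%N -> (i < j)%N -> (j < n)%N -> olt (ulift U (y *+ i)) (ulift U
  (y *+ j)).
  move=> i0 ij hj; have := hy 0%N i j i0 ij;
    rewrite size_rcons size_mkseq => /(_ (ltnW hj)).
  have hi := ltn_trans ij hj.
  rewrite !nth_rcons size_mkseq (ltn_trans i0 hi) hi hj !nth_mkseq ?(ltn_trans i0 hi)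
    // mulr0n.
  by move/(cyc0_ulift U) => [].
have z0 : ole 0 z by exact: ulift_ge0.
have zn_ge0 i : ole 0 (z *+ i).
  elim: i => [//|i IH]; rewrite mulrSr; apply: ole_trans IH _.
  by rewrite -{1}[z *+ i]addr0 ole_add2l.
have wrap i : olt (z *+ i) u -> ~ olt (z *+ i.+1) u -> ulift U (y *+ i.+1) = z *+
  i.+1 - u.
  move=> iu /oleNgt ui; rewrite -[y](uliftK U) -raddfMn -[in LHS]/z.
  rewrite -[upr U _]subr0 -(upr_uu U) -raddfB upr_ulift //.
    by rewrite -(ole_add2r u) add0r subrK.
  by rewrite -(olt_add2r u) subrK mulrSr; apply: olt_add => //; exact: ulift_lt.
have nowrap i : olt (z *+ i) u -> ulift U (y *+ i) = z *+ i.
  by move=> iu; rewrite -[y](uliftK U) -raddfMn -[in LHS]/z upr_ulift.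
(* The first multiple to wrap would have a smaller lift than its predecessor, against [yij]; for the
   multiple z itself it would mean z = z - u. *)
have zi i : (i < n)%N -> olt (z *+ i) u.
  elim: i => [|i IH] hi; first by rewrite olt0; exact: uu_pos.
  have iu := IH (ltnW hi); apply: contrapT => /(wrap _ iu) h.
  case: i {IH} hi iu h => [|i] hi iu h.
    rewrite !mulr1n -/z in h; have := uu_pos U.
    by rewrite -olt0 -(olt_add2l (z - u)) addr0 subrK -h => /olt_irr.
  have := yij i.+1 i.+2 isT (leqnn _) hi; rewrite h nowrap // (mulrSr z i.+1).
  move/(olt_asym); apply; rewrite -(olt_add2r u) subrK olt_add2l; exact: ulift_lt.
have zb : olt (z *+ n.-1) b by rewrite -nowrap; [apply: (yi _ _ _).2; lia|exact: zi].
have zn : olt (z *+ n) (b + b).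
  rewrite -(prednK (ltnW n2)) mulrSr; apply: olt_add => //.
  apply: ole_lt_trans zb; rewrite -(subnKC n2) /=.
  by rewrite addSn /= mulrS -{1}[z]addr0 ole_add2l.
have lny : ole a (ulift U (y *+ n)) /\ ole (ulift U (y *+ n)) b.
  case: hny => [->|->|]; rewrite ?lx0 ?lxn; [by split=> //; left|by split=> //; left|].
  move/(cyc_ulift U); rewrite lx0 lxn => -[[h1 h2]|[h1 h2]|[h1 h2]].
  - by split; left.
  - by case: (olt_asym ab).
  - by case: (olt_asym ab).
have znu : olt (z *+ n) u.
  apply: contrapT; rewrite -(prednK (ltnW n2)) => /(wrap _ (zi _ ln)) h.
  move: lny.1; rewrite prednK in h; last lia.
  rewrite h -(ole_add2r u) subrK addrC => h'.
  by apply: (@olt_irr _ (b + b)); exact: olt_trans ba (ole_lt_trans _ _ _ h' zn).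
exists z; rewrite -nowrap //; split; first exact: olt_le_trans va lny.1.
exact: ole_lt_trans lny.2 bw.
Qed.

(** w belongs to the closure of nW in the order topology. Unlike the statement about intervals, this
    is stable under sums and opposites, which carries it from [0, u[ to all of W. *)
Let adherent n w := forall d, opos d ->
  exists z, olt (w - d) (z *+ n) /\ olt (z *+ n) (w + d).

Lemma adherentD n v w : adherent n v -> adherent n w -> adherent n (v + w).
Proof.
move=> hv hw d; rewrite -olt0 => d0; have [d1 [d10 d1d]] := co_dense_order d0.
have [|z1 [h1 h2]] := hv d1; first by rewrite -olt0.
have [//|z2 [h3 h4]] := hw (d - d1).
exists (z1 + z2); rewrite mulrnDl; split.
  by have := olt_add h1 h3; rewrite /olt; congr opos; zring.
by have := olt_add h2 h4; rewrite /olt; congr opos; zring.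
Qed.

Lemma adherentN n w : adherent n w -> adherent n (- w).
Proof.
move=> hw d /hw [z [h1 h2]]; exists (- z); rewrite mulNrn.
split; [move: h2|move: h1]; rewrite /olt; congr opos; zring.
Qed.

Lemma adherent_fund n w : (1 < n)%N -> ole 0 w -> olt w u -> adherent n w.
Proof.
move=> n2 w0 wu d d0; have wd : olt w (w + d) by rewrite -{1}[w]addr0 olt_add2l olt0.
have dw : olt (w - d) w by rewrite /olt opprB addrC subrK.
case: (EM (olt (w + d) u)) => [h|/oleNgt h].
  have [z [h1 h2]] := c_regular_fund n2 w0 wd (or_introl h).
  by exists z; split=> //; exact: olt_trans h1.
have [z [h1 h2]] := c_regular_fund n2 w0 wu (ole_refl _).
by exists z; split; [exact: olt_trans h1|exact: olt_le_trans h].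
Qed.

Lemma adherent_all n w : (1 < n)%N -> adherent n w.
Proof.
(* The element u lies just outside [0, u[, so it is split into two elements of this interval. *)
move=> n2; have hu : adherent n u.
  have := uu_pos U; rewrite -olt0 => /co_dense_order [z [z0 zu]].
  rewrite -(subrKC z u); apply: adherentD; apply: adherent_fund => //.
  - by left.
  - by left; rewrite olt0.
  - by rewrite /olt opprB addrC subrK -olt0.
have h0 : adherent n 0.
  by apply: adherent_fund => //; rewrite olt0; exact: uu_pos.
have hk m : adherent n (u *+ m).
  by elim: m => [|m IH]; rewrite ?mulr0n // mulrS; exact: adherentD.
have hz k : adherent n (u *~ k).
  by case: k => m; rewrite ?NegzE ?mulrNz; [exact: hk|apply: adherentN; exact: hk].
have [k [h1 h2]] := ufloor w.
rewrite -(subrKC (u *~ k) w); apply: adherentD => //; apply: adherent_fund => //.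
  by rewrite -(ole_add2r (u *~ k)) add0r subrK.
by rewrite -(olt_add2r (u *~ k)) subrK; move: h2; rewrite mulrzDr mulr1z addrC.
Qed.

Lemma c_regular_regular : regular_dense U.
Proof.
move=> n v w n0 vw; have [n2|] := ltnP 1 n; last first.
  move=> n1; have -> : n = 1%N by lia.
  by have [z] := co_dense_order vw; exists z; rewrite mulr1n.
have [m [vm mw]] := co_dense_order vw.
have [d [d0 d1 d2]] : exists d, [/\ opos d, ole d (m - v) & ole d (w - m)].
  case: (EM (ole (m - v) (w - m))) => h.
    by exists (m - v); split=> //; exact: ole_refl.
  exists (w - m); split=> //; first by left; exact/oltNge.
have [z [h1 h2]] := adherent_all m n2 d0; exists z; split.
  apply: ole_lt_trans h1; rewrite -(ole_add2r (d - v)).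
  have -> : v + (d - v) = d by zring.
  by have -> : m - d + (d - v) = m - v by zring.
apply: olt_le_trans h2 _; rewrite -(ole_add2r (- m)).
by have -> : m + d - m = d by zring.
Qed.
End Converse.
End Regular.

(** * Independence modulo a prime *)

Definition lin (A : zmodType) (r : nat) (c : nat -> int) (g : nat -> A) : A :=
  \sum_(j < r) g j *~ c j.

Definition divides (A : zmodType) (m : nat) (w : A) := exists z, w = z *+ m.

(* g_0, ..., g_(r-1) are linearly independent over F_p in A / pA. *)
Definition indep (A : zmodType) (p r : nat) (g : nat -> A) :=
  forall c, divides p (lin r c g) -> forall j, (j < r)%N -> (p %| c j)%Z.

Lemma Bezout_coprime (m n : nat) : coprime m n ->
  exists s t : int, s * m%:Z + t * n%:Z = 1.
Proof.
move=> cop; have /coprimezP [[s t] /= h] : coprimez m n by rewrite /coprimez /gcdz /=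
  (eqP cop).
by exists s, t.
Qed.

Lemma Bezout_prime (p : nat) (k : int) : prime p -> ~~ (p %| k)%Z ->
  exists s t : int, s * p%:Z + t * k = 1.
Proof.
move=> pp; rewrite dvdzE -prime_coprime // => cop.
by have /coprimezP [[s t] /= e] : coprimez p k; [exact: cop|exists s, t].
Qed.

Section Lin.
Variable A : zmodType.
Implicit Types (g : nat -> A) (c d : nat -> int) (r m n : nat) (w : A).

Lemma lin_ext r c d g g' : (forall j, (j < r)%N -> c j = d j) ->
  (forall j, (j < r)%N -> g j = g' j) -> lin r c g = lin r d g'.
Proof. by move=> h1 h2; apply: eq_bigr => j _; rewrite h1 ?h2. Qed.

Lemma lin0 c g : lin 0 c g = 0. Proof. exact: big_ord0. Qed.

Lemma linS r c g : lin r.+1 c g = lin r c g + g r *~ c r.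
Proof. exact: big_ord_recr. Qed.

Lemma linD r c d g : lin r (fun j => c j + d j) g = lin r c g + lin r d g.
Proof. by rewrite -big_split; apply: eq_bigr => j _; rewrite mulrzDr. Qed.

Lemma linZ r c k g : lin r (fun j => c j * k) g = lin r c g *~ k.
Proof. by rewrite /lin mulrz_suml; apply: eq_bigr => j _; rewrite mulrzA. Qed.

Lemma linN r c g : lin r (fun j => - c j) g = - lin r c g.
Proof. by rewrite /lin -sumrN; apply: eq_bigr => j _; rewrite mulrNz. Qed.

Lemma linB r c d g : lin r (fun j => c j - d j) g = lin r c g - lin r d g.
Proof. by rewrite linD linN. Qed.

Lemma lin_lin K r c (rho : nat -> nat -> int) g :
  lin K c (fun i => lin r (rho i) g) =
  lin r (fun l => \sum_(i < K) rho i l * c i) g.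
Proof.
rewrite /lin; under eq_bigr do rewrite mulrz_suml.
rewrite exchange_big; apply: eq_bigr => l _ /=; rewrite mulrz_sumr.
by apply: eq_bigr => i _; rewrite mulrzA.
Qed.

Lemma lin_set r c g i x : (i < r)%N ->
  lin r c [eta g with i |-> x] = lin r [eta c with i |-> 0] g + x *~ c i.
Proof.
move=> ir; rewrite /lin (bigD1 (Ordinal ir)) // [in RHS](bigD1 (Ordinal ir)) //=.
rewrite eqxx mulr0z add0r addrC; congr (_ + _); apply: eq_bigr => j.
by rewrite -val_eqE /= => /negbTE ->.
Qed.

Lemma lin_last r c g x : lin r.+1 c [eta g with r |-> x] = lin r c g + x *~ c r.
Proof.
rewrite linS /= eqxx; congr (_ + _); apply: lin_ext => // j jr /=.
by rewrite ltn_eqF.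
Qed.

Lemma lin_delta r i k g : (i < r)%N -> lin r (fun j => if j == i then k else 0) g = g
  i *~ k.
Proof.
move=> ir; rewrite /lin (bigD1 (Ordinal ir)) //= eqxx big1 ?addr0 // => j.
by rewrite -val_eqE /= => /negbTE ->; rewrite mulr0z.
Qed.

Lemma dividesD m v w : divides m v -> divides m w -> divides m (v + w).
Proof. by move=> [x ->] [y ->]; exists (x + y); rewrite mulrnDl. Qed.

Lemma dividesN m w : divides m w -> divides m (- w).
Proof. by move=> [x ->]; exists (- x); rewrite mulNrn. Qed.

Lemma dividesB m v w : divides m v -> divides m w -> divides m (v - w).
Proof. by move=> h1 h2; apply/dividesD => //; apply: dividesN. Qed.

Lemma dividesMz m w k : divides m w -> divides m (w *~ k).
Proof. by move=> [x ->]; exists (x *~ k); zring. Qed.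

Lemma divides_dvdz m w k : (m %| k)%Z -> divides m (w *~ k).
Proof. by move=> /dvdzP [q ->]; exists (w *~ q); zring. Qed.

Lemma divides_trans m n w : (m %| n)%N -> divides n w -> divides m w.
Proof. by move=> /dvdnP [q ->] [z ->]; exists (z *+ q); rewrite -mulrnA. Qed.

Lemma divides0 m : divides m (0 : A).
Proof. by exists 0; rewrite mul0rn. Qed.

Lemma divides1 w : divides 1 w.
Proof. by exists w. Qed.

Lemma divides_coprime m n w : coprime m n -> divides m w -> divides n w ->
  divides (m * n) w.
Proof.
move=> /Bezout_coprime [s [t st]] [x hx] [y hy]; exists (y *~ s + x *~ t).
transitivity (y *+ n *~ (s * m) + x *+ m *~ (t * n)); last by zring.
by rewrite -hx -hy -mulrzDr st mulr1z.
Qed.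

Lemma divides_logn m w : (0 < m)%N ->
  (forall p, prime p -> divides (p ^ logn p m) w) -> divides m w.
Proof.
elim/ltn_ind: m => m IH m0 h; have [m1|m1] := leqP m 1.
  have -> : m = 1%N by lia.
  exact: divides1.
have pr := pdiv_prime m1; set p := pdiv m in pr *.
have [q cop mE] := pfactor_coprime pr m0.
have lp : (0 < logn p m)%N by rewrite logn_gt0 mem_primes pr m0 pdiv_dvd.
have q0 : (0 < q)%N by move: m0; rewrite mE muln_gt0 => /andP[].
rewrite mE; apply: divides_coprime; last exact: h.
- by rewrite coprime_sym; exact: coprimeXl.
- apply: IH => //.
    rewrite [X in (_ < X)%N]mE -{1}[q]muln1 ltn_pmul2l //;
      apply: leq_trans (prime_gt1 pr) _.
    by rewrite -{1}[p]expn1 leq_exp2l // prime_gt1.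
- move=> r rr; apply: divides_trans (h _ rr); rewrite dvdn_exp2l //.
  rewrite [X in (_ <= logn _ X)%N]mE lognM ?leq_addr // expn_gt0; apply/orP; left;
    exact: prime_gt0.
Qed.

(** The Chinese remainder theorem for a Z-module: the correction z q - w is multiplied by a multiple
    of M that is 1 modulo q^e. *)
Lemma simultaneous_congruences (s : seq nat) e (z : nat -> A) :
  uniq s -> all prime s ->
  exists w, forall p, p \in s -> divides (p ^ e) (w - z p).
Proof.
elim: s => [_ _|q s IH /= /andP[qs us] /andP[pq ps]]; first by exists 0.
have [w hw] := IH us ps; pose M := (\prod_(p <- s) p ^ e)%N.
have copM : coprime M (q ^ e).
  rewrite /M coprime_sym; elim: s qs ps {us IH w hw M} => [|p s IH].
    by rewrite big_nil coprimen1.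
  rewrite inE negb_or big_cons => /andP[qp qs] /= /andP[pp ps].
  by rewrite coprimeMr IH // andbT coprimeXl // coprimeXr // prime_coprime //
    dvdn_prime2.
have [a [b ab]] := Bezout_coprime copM.
exists (w + (z q - w) *~ (a * M%:Z)) => p; rewrite inE => /orP[/eqP->|pin].
  have -> : w + (z q - w) *~ (a * M%:Z) - z q = (w - z q) *~ (1 - a * M%:Z) by zring.
  apply: divides_dvdz; apply/dvdzP; exists b; lia.
rewrite addrAC; apply: dividesD; first exact: hw.
apply: divides_dvdz; apply: dvdz_mull; rewrite dvdzE /=.
by rewrite /M (big_rem p) //= dvdn_mulr.
Qed.

(** A relation whose last coefficient is prime to p can be solved for w modulo p by a Bezout
    inverse. *)
Lemma indep_extend p r g w : prime p -> indep p r g ->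
  ~ (exists c, divides p (w - lin r c g)) -> indep p r.+1 [eta g with r |-> w].
Proof.
move=> pp ig nw c; rewrite lin_last => h.
have [pc|pc] := boolP (p %| c r)%Z.
  move=> j; rewrite ltnS leq_eqVlt => /orP[/eqP-> //|jr]; apply: (ig c) jr.
  rewrite -[lin _ _ _](addrK (w *~ c r)); apply: dividesB => //; exact: divides_dvdz.
case: nw; have [s [t st]] := Bezout_prime pp pc.
exists (fun j => c j * - t); rewrite linZ mulrNz opprK.
have -> : w + lin r c g *~ t = w *~ (1 - t * c r) + (lin r c g + w *~ c r) *~ t.
  by zring.
apply: dividesD; last exact: dividesMz.
by apply: divides_dvdz; apply/dvdzP; exists s; lia.
Qed.

Let ext p r (f : {ffun 'I_r -> 'I_p}) (j : nat) : int :=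
  oapp (fun o => (f o : nat)%:Z) 0 (insub j).

Let extE p r (f : {ffun 'I_r -> 'I_p}) (o : 'I_r) : ext f o = (f o : nat)%:Z.
Proof. by rewrite /ext valK. Qed.

(** The p^r combinations with coefficients in [0, p[ are pairwise incongruent. With
    [span_incongruent], this converts sizes of incongruent families into dimensions over F_p. *)
Lemma indep_incongruent p r g : indep p r g -> incongruent_family A p (p ^ r).
Proof.
move=> ig; have e : (p ^ r = #|{: {ffun 'I_r -> 'I_p}}|)%N by rewrite card_ffun
  !card_ord.
pose F (i : 'I_(p ^ r)) : {ffun 'I_r -> 'I_p} := enum_val (cast_ord e i).
exists (fun i => lin r (ext (F i)) g) => i j /eqP ij; rewrite /congruent -linB => h.
apply: ij; apply: (@cast_ord_inj _ _ e); apply: enum_val_inj; apply/ffunP => o;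
  apply: val_inj.
have := ig _ h _ (ltn_ord o); rewrite !extE -/(F i) -/(F j) /=.
move: (F i o) (F j o) => [a ap] [b bp] /= /dvdzP[q].
by have [q0|q0|->] := ltgtP q 0; nia.
Qed.

Lemma span_incongruent p r g m : (0 < p)%N ->
  (forall w, exists c, divides p (w - lin r c g)) ->
  incongruent_family A p m -> (m <= p ^ r)%N.
Proof.
move=> p0 sp [u hu]; pose c i := projT1 (cid (sp (u i))).
have hc i : divides p (u i - lin r (c i) g) by rewrite /c; case: cid.
have mod_lt k : (`|(k %% p)%Z| < p)%N by have := ltz_mod k (d := p%:Z);
  have := modz_ge0 k (d := p%:Z); lia.
pose F i : {ffun 'I_r -> 'I_p} := [ffun o : 'I_r => Ordinal (mod_lt (c i o))].
have -> : (p ^ r = #|{: {ffun 'I_r -> 'I_p}}|)%N by rewrite card_ffun !card_ord.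
rewrite -[X in (X <= _)%N]card_ord; apply: (leq_card F) => i j Fij.
apply/eqP/contraT => /hu; case; rewrite /congruent.
have -> : u i - u j = (u i - lin r (c i) g) - (u j - lin r (c j) g) + lin r (fun l =>
  c i l - c j l) g.
  by rewrite linB; zring.
apply: dividesD; first exact: dividesB.
have: forall l, (l < r)%N -> (p %| c i l - c j l)%Z.
  move=> l lr; have := congr1 (fun f : {ffun 'I_r -> 'I_p} => val (f (Ordinal lr))) Fij.
  rewrite !ffunE /= -eqz_mod_dvd => h; apply/eqP.
  have := modz_ge0 (c i l) (d := p%:Z); have := modz_ge0 (c j l) (d := p%:Z); lia.
move=> h; apply: big_ind => [||l _]; [exact: divides0|exact: dividesD|].
exact/divides_dvdz/h.
Qed.

Lemma incongruent_le p m n : (m <= n)%N ->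
  incongruent_family A p n -> incongruent_family A p m.
Proof.
move=> mn [u hu]; exists (fun i => u (widen_ord mn i)) => i j ij; apply: hu.
by apply: contra ij => /eqP/(congr1 val) /= h; apply/eqP/val_inj.
Qed.

(** As long as the remainder v depends on g modulo p, a combination of g is subtracted from it and
    the difference is divided by p. The process reaches height e or stops at a new independent
    element. *)
Lemma indep_decomp p r g w e : prime p -> indep p r g ->
  exists t h v, w = lin r t g + v *+ (p ^ h) /\
    (h = e \/ (h < e)%N /\ indep p r.+1 [eta g with r |-> v]).
Proof.
move=> pp ig; elim: e => [|e [t [h [v [wE hv]]]]].
  exists (fun=> 0), 0%N, w; split; last by left.
  by rewrite mulr1n /lin big1 ?add0r // => *; rewrite mulr0z.
case: hv => [he|[he iv]]; last by exists t, h, v; split=> //; right; split=> //;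
  exact: ltnW.
rewrite {}he in wE.
case: (EM (exists c, divides p (v - lin r c g))) => [[c [z hz]]|nv]; last first.
  by exists t, e, v; split=> //; right; split=> //; exact: indep_extend.
exists (fun j => t j + c j * (p ^ e)%N%:Z), e.+1, z; split; last by left.
rewrite linD linZ wE expnS mulrnA -hz; zring.
Qed.
End Lin.

(** Independence modulo p gives divisibility of the coefficients by p; as W is torsion-free, the
    relation can then be divided by p and the argument repeated. *)
Lemma indep_height (W : ogroup) p r (g : nat -> W) s c : prime p -> indep p r g ->
  divides (p ^ s) (lin r c g) -> forall j, (j < r)%N -> ((p ^ s)%N %| c j)%Z.
Proof.
move=> pp ig; elim: s c => [|s IH] c; first by move=> _ j _; rewrite dvdzE /= dvd1n.
move=> [z hz] j jr; have pc j' : (j' < r)%N -> (p %| c j')%Z.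
  by apply: ig; exists (z *+ (p ^ s)); rewrite hz expnSr mulrnA.
have p0 : (p%:Z != 0) by have := prime_gt0 pp; lia.
have lE : lin r c g = lin r (fun j => (c j %/ p)%Z) g *~ p.
  by rewrite -linZ; apply: lin_ext => // i ir; rewrite divzK // pc.
have /IH/(_ _ jr) : divides (p ^ s) (lin r (fun j => (c j %/ p)%Z) g).
  exists z; apply: (omulrzI p0) => /=; rewrite -lE hz expnSr; zring.
move=> /dvdzP [q hq]; apply/dvdzP; exists q.
by rewrite -(divzK (pc _ jr)) hq expnSr PoszM mulrA.
Qed.

Lemma divides_mulI (W : ogroup) m n (w : W) : (0 < n)%N ->
  divides (m * n) (w *+ n) -> divides m w.
Proof.
move=> n0 [z hz]; exists z; have nz : (n%:Z != 0) by lia.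
by apply: (omulrzI nz) => /=; rewrite -!pmulrn hz mulrnA.
Qed.

(** * Incongruent families in a group and in its unwinding *)

Section Transfer.
Variables (G : coGroup) (U : unwinding G).

(** When p divides u, the kernel of the projection lies in pW, so that W / pW and G / pG
    coincide. *)
Lemma incongruent_upr p m : divides p (uu U) ->
  incongruent_family U p m <-> incongruent_family G p m.
Proof.
move=> [z hz]; split=> [[f hf]|[f hf]].
  exists (upr U \o f) => i j /hf h [y hy]; apply: h.
  move: hy; rewrite /congruent -(uliftK U y) -raddfMn /= -raddfB => /upr_eq [k ->].
  apply: dividesD; first by exists (ulift U y).
  by rewrite hz; exists (z *~ k); zring.
exists (ulift U \o f) => i j /hf h [y hy]; apply: h.
by exists (upr U y); rewrite -raddfMn -hy raddfB /= !uliftK.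
Qed.

(** When p does not divide u, the elements 0, u, ..., (p-1) u are pairwise incongruent, so each
    class of G / pG lifts to p classes of W / pW. *)
Lemma incongruent_unwind p m : prime p -> ~ divides p (uu U) ->
  incongruent_family G p m -> incongruent_family U p (p * m).
Proof.
move=> pp nu [f hf]; have e : (p * m = #|{: 'I_p * 'I_m}|)%N by rewrite card_prod
  !card_ord.
pose F (i : 'I_(p * m)) : 'I_p * 'I_m := enum_val (cast_ord e i).
exists (fun i => ulift U (f (F i).2) + uu U *~ (F i).1%:Z) => i j /eqP ij [z hz].
have e2 : (F i).2 = (F j).2.
  apply/eqP/contraT => /hf []; exists (upr U z); rewrite -raddfMn -hz.
  by rewrite raddfB !raddfD /= !uliftK !upr_uM oppr0 !addr0.
apply: ij; apply: (@cast_ord_inj _ _ e); apply: enum_val_inj; rewrite -/(F i) -/(F j).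
rewrite [LHS]surjective_pairing [RHS]surjective_pairing e2; congr (_, _);
  apply: val_inj.
have {hz} : divides p (uu U *~ ((F i).1%:Z - (F j).1%:Z)).
  by exists z; rewrite -hz e2; zring.
case: (F i).1 (F j).1 => [a ap] [b bp] /= hz.
have [dv|ndv] := boolP (p %| a%:Z - b%:Z)%Z.
  by move: dv => /dvdzP[q]; have [q0|q0|->] := ltgtP q 0; nia.
case: nu; have [s [t st]] := Bezout_prime pp ndv.
rewrite -[uu U]mulr1z -st mulrzDr; apply: dividesD; first exact/divides_dvdz/dvdz_mull.
by rewrite mulrC mulrzA; exact: dividesMz.
Qed.

(** Above each class of G / pG lie at most p classes of W / pW. If G has no family of size m, it has
    a family that cannot be enlarged; this one represents every class of G / pG, so counting applies
    even though [p]G is not given as a number. *)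
Lemma incongruent_pr p m : (0 < p)%N -> incongruent_family U p m ->
  exists n, incongruent_family G p n /\ (m <= p * n)%N.
Proof.
move=> p0 [f hf]; case: (EM (incongruent_family G p m)) => [h|nm].
  by exists m; split=> //; exact: leq_pmull.
have [n [hn hn1]] : exists n, incongruent_family G p n /\ ~ incongruent_family G p n.+1.
  apply: contrapT => h; apply: nm; elim: m {f hf} => [|k IH].
    by exists (fun=> 0) => -[].
  by apply: contrapT => hk; apply: h; exists k.
exists n; split=> //; have [v hv] := hn.
have sp (x : G) : exists i, congruent p x (v i).
  apply: contrapT => h; apply: hn1.
  exists (fun i => if unlift ord_max i is Some j then v j else x) => i j.
  case: unliftP => [i' ->|->]; case: unliftP => [j' ->|->] //.
  - by move=> ne; apply: hv; apply: contra ne => /eqP->.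
  - move=> _ [z hz]; apply: h; exists i', (- z).
    by rewrite mulNrn -hz opprB.
  - by move=> _ hz; apply: h; exists j'.
  - by rewrite eqxx.
have sp' (w : U) : exists ik : 'I_n * 'I_p, divides p (w - (ulift U (v ik.1) + uu U
  *~ ik.2%:Z)).
  have [i [z]] := sp (upr U w);
    rewrite -(uliftK U (v i)) -(uliftK U z) -raddfMn -raddfB.
  move=> /upr_eq [k hk].
  have lt : (`|(k %% p)%Z| < p)%N by have := ltz_mod k (d := p%:Z);
    have := modz_ge0 k (d := p%:Z); lia.
  exists (i, Ordinal lt) => /=; rewrite opprD addrA hk.
  rewrite -addrA; apply: dividesD; first by exists (ulift U z).
  rewrite -mulrzBr; apply: divides_dvdz; rewrite gez0_abs ?modz_ge0 //; last lia.
  by apply/dvdzP; exists (k %/ p)%Z; have := divz_eq k p; lia.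
pose F i := projT1 (cid (sp' (f i))).
have hF i : divides p (f i - (ulift U (v (F i).1) + uu U *~ (F i).2%:Z)) by rewrite
  /F; case: cid.
have -> : (p * n = #|{: 'I_n * 'I_p}|)%N by rewrite card_prod !card_ord mulnC.
rewrite -[X in (X <= _)%N]card_ord; apply: (leq_card F) => i j Fij.
apply/eqP/contraT => /hf []; have := dividesB (hF i) (hF j).
by rewrite Fij /congruent /divides;
  have -> : forall a b c : U, a - b - (c - b) = a - c by move=> a b c; zring.
Qed.
End Transfer.

(** If [g'] could not be extended it would span V / pV, whose incongruent families then have at most
    p^r elements; but the r + 1 independent elements [g] yield a family of size at least p^(r+1),
    which transfers from U to V through G and H. *)
Lemma same_dimension (G H : coGroup) (U : unwinding G) (V : unwinding H) p r g g' :
  prime p -> (forall m, incongruent_family G p m <-> incongruent_family H p m) ->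
  (divides p (uu U) <-> divides p (uu V)) ->
  indep (A := U) p r.+1 g -> indep (A := V) p r g' ->
  exists x, indep p r.+1 [eta g' with r |-> x].
Proof.
move=> pp GH uv ig ig'; apply: contrapT => nx; have p1 := prime_gt1 pp.
have sp w : exists c, divides p (w - lin r c g').
  by apply: contrapT => h; apply: nx; exists w; exact: indep_extend.
have big := indep_incongruent ig.
have small := span_incongruent (ltnW p1) sp.
suff : (p ^ r.+1 <= p ^ r)%N by rewrite leq_exp2l // ltnn.
case: (EM (divides p (uu U))) => du.
  by apply: small; apply/(incongruent_upr _ (uv.1 du))/GH/(incongruent_upr _ du).
have [n [hn hle]] := incongruent_pr (ltnW p1) big.
apply: leq_trans hle (small _ _); apply: incongruent_unwind => //; first by move/uv.
exact/GH.
Qed.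

(** * Back and forth *)

Section Agreement.
Variables (W W' : ogroup).
Implicit Types (a : nat -> W) (b : nat -> W') (c : nat -> int).

(* Modulo p^e the tuples a and b have the same coordinates in families that
   are linearly independent over F_p. *)
Definition same_residues K p e a b := exists r g g' (rho : nat -> nat -> int),
  [/\ indep p r g, indep p r g',
      forall i, (i < K)%N -> divides (p ^ e) (a i - lin r (rho i) g)
    & forall i, (i < K)%N -> divides (p ^ e) (b i - lin r (rho i) g')].

Definition same_signs K n a b := forall c, (forall i, `|c i| <= n%:Z) ->
  (opos (lin K c a) <-> opos (lin K c b)).

(* The relation preserved, with n decreasing, in the back-and-forth argument. *)
Definition agree K n a b := same_signs K n a b /\
  forall p, prime p -> (p <= n)%N -> same_residues K p n a b.

Lemma lin_residue (A : zmodType) m K r c (rho : nat -> nat -> int) (a g : nat -> A) :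
  (forall i, (i < K)%N -> divides m (a i - lin r (rho i) g)) ->
  divides m (lin K c a - lin r (fun l => \sum_(i < K) rho i l * c i) g).
Proof.
move=> h; rewrite -lin_lin /lin -sumrB; apply: big_ind => [||i _].
- exact: divides0.
- exact: dividesD.
by rewrite -mulrzBl; apply: dividesMz; exact: h.
Qed.

(** A combination is divisible by p^s exactly when its coordinates in the independent family are,
    and the two tuples share these coordinates modulo p^e. *)
Lemma same_residues_divides K p e a b s c : prime p -> same_residues K p e a b ->
  (s <= e)%N -> divides (p ^ s) (lin K c a) -> divides (p ^ s) (lin K c b).
Proof.
move=> pp [r [g [g' [rho [ig ig' ha hb]]]]] se da.
have sub : ((p ^ s) %| (p ^ e))%N by rewrite dvdn_exp2l.
have /indep_height h : divides (p ^ s) (lin r (fun l => \sum_(i < K) rho i l * c i) g).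
  have := dividesB da (divides_trans sub (lin_residue c ha)).
  by rewrite opprB subrKC.
have {}h := h pp ig.
have : divides (p ^ s) (lin r (fun l => \sum_(i < K) rho i l * c i) g').
  apply: big_ind => [||l _]; [exact: divides0|exact: dividesD|].
  exact/divides_dvdz/h.
by move/(dividesD (divides_trans sub (lin_residue c hb))); rewrite subrK.
Qed.

Lemma same_residues_le K p e e' a b : (e' <= e)%N ->
  same_residues K p e a b -> same_residues K p e' a b.
Proof.
move=> le [r [g [g' [rho [ig ig' ha hb]]]]]; exists r, g, g', rho.
have sub : ((p ^ e') %| (p ^ e))%N by rewrite dvdn_exp2l.
by split=> // i iK; apply: divides_trans sub _; auto.
Qed.

Lemma agree_le K n n' a b : (n' <= n)%N -> agree K n a b -> agree K n' a b.
Proof.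
move=> le [hs hr]; split=> [c hc|p pp pn].
  by apply: hs => i; apply: le_trans (hc i) _; lia.
by apply: same_residues_le le (hr _ pp (leq_trans pn le)).
Qed.

Lemma agree_lin0 K n a b c : agree K n a b -> (forall i, `|c i| <= n%:Z) ->
  lin K c a = 0 -> lin K c b = 0.
Proof.
move=> [hs _] hc c0; case: (opos_total (lin K c b)) => //.
  by move/(hs _ hc); rewrite c0 => /opos0.
rewrite -linN => /(hs (fun i => - c i)); rewrite linN c0 oppr0 => h.
by case: (@opos0 W); apply: h => i; rewrite normrN.
Qed.

(* Solves x j = lin r s g modulo p^(e + v_p(j)). *)
Lemma residue_div (V : ogroup) p e j r s (g : nat -> V) : prime p -> (0 < j)%N ->
  indep p r g -> (forall l, (l < r)%N -> ((p ^ logn p j)%N %| s l)%Z) ->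
  exists t : nat -> int, forall (V' : ogroup) (g' : nat -> V') (x : V'),
    divides (p ^ (e + logn p j)) (x *+ j - lin r s g') ->
    divides (p ^ e) (x - lin r t g').
Proof.
move=> pp j0 ig ds; set v := logn p j in ds *.
have [q cop jE] := pfactor_coprime pp j0; rewrite -/v in jE.
have [al [be e1]] := Bezout_coprime (coprimeXl e cop).
(* The integer [be] inverts q, the part of j prime to p, modulo p^e. These coordinates depend on s
   and j only, so they serve both groups. *)
exists (fun l => (s l %/ (p ^ v)%N)%Z * be) => V' g' x [z hz].
have pv0 : (0 < p ^ v)%N by rewrite expn_gt0 prime_gt0.
have lE : lin r s g' = lin r (fun l => (s l %/ (p ^ v)%N)%Z) g' *~ (p ^ v)%N.
  by rewrite -linZ; apply: lin_ext => // l lr; rewrite divzK // ds.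
have h : x *+ q - lin r (fun l => (s l %/ (p ^ v)%N)%Z) g' = z *+ (p ^ e).
  have pvz : ((p ^ v)%N%:Z != 0) by lia.
  apply: (omulrzI pvz) => /=; rewrite mulrzBl -lE -!pmulrn -!mulrnA -jE hz expnD.
  by rewrite pmulrn.
rewrite linZ; set L := lin _ _ _ in h *.
have -> : x - L *~ be = x *~ (1 - be * q%:Z) + (x *+ q - L) *~ be by zring.
rewrite h; apply: dividesD; last by apply: dividesMz; exists z.
by apply: divides_dvdz; apply/dvdzP; exists al; lia.
Qed.

(** Division by j costs v_p(j) powers of p, hence the stronger precision N required of a and b. *)
Lemma same_residues_solve K p e N a b i j c x y : prime p -> (i < K)%N ->
  (0 < j)%N -> (e + logn p j <= N)%N -> same_residues K p N a b ->
  x *+ j = lin K c a -> y *+ j = lin K c b ->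
  same_residues K p e [eta a with i |-> x] [eta b with i |-> y].
Proof.
move=> pp iK j0 eN [r [g [g' [rho [ig ig' ha hb]]]]] xj yj.
have sub : ((p ^ (e + logn p j)) %| (p ^ N))%N by rewrite dvdn_exp2l.
have le : ((p ^ e) %| (p ^ N))%N by rewrite dvdn_exp2l //; lia.
pose s l := \sum_(i < K) rho i l * c i.
have da := divides_trans sub (lin_residue c ha); rewrite -xj -/s in da.
have db := divides_trans sub (lin_residue c hb); rewrite -yj -/s in db.
have ds l : (l < r)%N -> ((p ^ logn p j)%N %| s l)%Z.
  apply: (indep_height pp ig).
  have h : divides (p ^ logn p j) (x *+ j).
    by rewrite pmulrn; apply: divides_dvdz; rewrite dvdzE /= pfactor_dvdnn.
  have := dividesB h (divides_trans _ da); rewrite opprB subrKC; apply.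
  by rewrite dvdn_exp2l // leq_addl.
have [t ht] := residue_div e pp j0 ig ds.
exists r, g, g', [eta rho with i |-> t]; split=> // k kK /=.
  by case: eqP => _; [exact: ht|apply: divides_trans le _; exact: ha].
by case: eqP => _; [exact: ht|apply: divides_trans le _; exact: hb].
Qed.

(** The residue of x is either already expressed by g or needs one new independent element, whose
    partner in W' exists by the comparison of dimensions. Only the residue of y is constrained,
    which leaves its place in the order free. *)
Lemma same_residues_extend K p e a b i x : prime p -> (i < K)%N ->
  (forall r g g', indep (A := W) p r.+1 g -> indep (A := W') p r g' ->
     exists x, indep p r.+1 [eta g' with r |-> x]) ->
  same_residues K p e a b -> exists z, forall y, divides (p ^ e) (y - z) ->
  same_residues K p e [eta a with i |-> x] [eta b with i |-> y].
Proof.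
move=> pp iK hdim [r [g [g' [rho [ig ig' ha hb]]]]].
have [t [h [v [xE hv]]]] := indep_decomp x e pp ig.
case: hv => [he|[he iv]].
  exists (lin r t g') => y hy; exists r, g, g', [eta rho with i |-> t].
  split=> // k kK /=; case: eqP => _; auto.
  by exists v; rewrite xE he addrC addKr.
have [v' iv'] := hdim _ _ _ iv ig'.
exists (lin r t g' + v' *+ p ^ h) => y hy.
pose ext (s : nat -> int) k := [eta s with r |-> k].
have extE (A : zmodType) (g0 : nat -> A) w s k :
    lin r.+1 (ext s k) [eta g0 with r |-> w] = lin r s g0 + w *~ k.
  rewrite lin_last /ext /= eqxx; congr (_ + _); apply: lin_ext => // l lr /=.
  by rewrite ltn_eqF.
exists r.+1, [eta g with r |-> v], [eta g' with r |-> v'],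
  (fun k => if k == i then ext t (p ^ h)%N else ext (rho k) 0).
split=> // k kK /=; case: eqP => ki; rewrite extE ?mulr0z ?addr0; auto.
by rewrite -pmulrn -xE subrr; exact: divides0.
Qed.
End Agreement.

Lemma agree_sym (W W' : ogroup) K n (a : nat -> W) (b : nat -> W') :
  agree K n a b -> agree K n b a.
Proof.
move=> [hs hr]; split=> [c hc|p pp pn]; first by apply: iff_sym; exact: hs.
have [r [g [g' [rho [ig ig' ha hb]]]]] := hr p pp pn.
by exists r, g', g, rho.
Qed.

Lemma opos_asym (W : ogroup) (x : W) : opos x -> ~ opos (- x).
Proof. by move=> h1 h2; apply: (@opos0 W); rewrite -(subrr x); exact: oposD. Qed.

(** * One step of the back-and-forth *)

Section Step.
Variables (W W' : ogroup).
Hypothesis W'_reg : regular_dense W'.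
Hypothesis dim_le : forall p r g g', prime p -> indep (A := W) p r.+1 g ->
  indep (A := W') p r g' -> exists x, indep p r.+1 [eta g' with r |-> x].
Variables (K n i : nat).
Hypothesis iK : (i < K)%N.

(** The summands cover three needs: 2 n n! bounds the coefficients when two cut conditions are
    compared after scaling to n! x, 2 n^2 those obtained by substituting a solution of j x = lin c,
    and 2 n the precision n + v_p(j) of the residues. *)
Let N := (2 * n * n`! + 2 * n * n + 2 * n)%N.

(** Divisibility of the matching combination by j can be read off its residues at the primes
    dividing j, so the equation is solvable in W'. Signs involving the solution are compared after
    multiplication by j. *)
Lemma agree_step_algebraic (a : nat -> W) (b : nat -> W') x j c :
  agree K N a b -> (0 < j)%N -> (j <= n)%N -> (forall l, `|c l| <= n%:Z) ->
  x *+ j = lin K c a ->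
  exists y, agree K n [eta a with i |-> x] [eta b with i |-> y].
Proof.
move=> [hs hr] j0 jn hc xj.
have [y] : divides j (lin K c b).
  apply: divides_logn => // p pp; have [->|lp] := posnP (logn p j);
    first exact: divides1.
  have pj : (p <= j)%N by move: lp; rewrite logn_gt0 mem_primes => /and3P[_ _];
    exact: dvdn_leq.
  have lj := ltn_logl p j0.
  apply: (same_residues_divides pp (hr p pp _)); [lia|lia|].
  rewrite -xj pmulrn; apply: divides_dvdz; rewrite dvdzE /=; exact: pfactor_dvdnn.
move/esym => yj; exists y; split=> [d hd|p pp pn].
  have jz : 0 < j%:Z by lia.
  rewrite !lin_set // -(opos_mulrz _ jz) -(opos_mulrz (_ + y *~ _) jz).
  have e (V : ogroup) (v : V) (g : nat -> V) : v *+ j = lin K c g ->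
      (lin K [eta d with i |-> 0] g + v *~ d i) *~ j =
      lin K (fun l => [eta d with i |-> 0] l * j + c l * d i) g.
    by move=> h; rewrite linD !linZ -h; zring.
  rewrite (e _ _ _ xj) (e _ _ _ yj); apply: hs => l /=.
  have hl := hc l; have hdi := hd i; have hdl := hd l.
  have h1 : `|(if l == i then 0 else d l) * j%:Z| <= n%:Z * n%:Z.
    rewrite normrM; apply: ler_pM => //.
    by case: eqP => // _; rewrite normr0.
  have h2 : `|c l * d i| <= n%:Z * n%:Z by rewrite normrM; apply: ler_pM.
  apply: le_trans (ler_normD _ _) (le_trans (lerD h1 h2) _).
  by rewrite /N; nia.
have lj := ltn_logl p j0.
apply: (same_residues_solve pp iK j0 _ (hr p pp _) xj yj); lia.
Qed.

(** Coefficients in [-n, n], shifted by n so as to form a finite type. Slot i is about to receive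
    the new element and gets coefficient 0. *)
Let cf (f : {ffun 'I_K -> 'I_(2 * n).+1}) (l : nat) : int :=
  if l == i then 0 else oapp (fun o => (f o)%:Z - n%:Z) 0 (insub l).

Let cf_le f l : `|cf f l| <= n%:Z.
Proof.
rewrite /cf; case: eqP => _; first by rewrite normr0.
case: insubP => [o _ _|_] /=; last by rewrite normr0.
by have := ltn_ord (f o); lia.
Qed.

Let cfE c : (forall l, `|c l| <= n%:Z) ->
  exists f, forall l, (l < K)%N -> cf f l = [eta c with i |-> 0] l.
Proof.
move=> hc; have lt l : (`|(c l + n%:Z)%R|%N < (2 * n).+1)%N by have := hc l; lia.
exists [ffun o : 'I_K => Ordinal (lt o)] => l lK; rewrite /cf /=; case: eqP => // _.
by rewrite insubT /= ffunE /=; have := hc l; lia.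
Qed.

(** Each comparison of j x with a bounded combination is scaled to one with n! x. Every lower bound
    of n! x is below every upper bound; these are finitely many signs of combinations of a, so the
    corresponding bounds in W' also leave a gap. *)
Lemma agree_step_cut (a : nat -> W) (b : nat -> W') x : agree K N a b ->
  (forall j c, (0 < j)%N -> (j <= n)%N -> (forall l, `|c l| <= n%:Z) ->
     x *+ j <> lin K c a) -> forall u : W', opos u ->
  exists y y', olt y y' /\ forall j c, (0 < j)%N -> (j <= n)%N ->
    (forall l, `|c l| <= n%:Z) -> c i = 0 ->
    (olt (lin K c a) (x *+ j) -> ole (lin K c b *+ (n`! %/ j)) y) /\
    (olt (x *+ j) (lin K c a) -> ole y' (lin K c b *+ (n`! %/ j))).
Proof.
move=> [hs _] hx u u0; pose T : finType := ({ffun 'I_K -> 'I_(2 * n).+1} * 'I_n)%type.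
pose lower (t : T) := `[< olt (lin K (cf t.1) a) (x *+ t.2.+1) >].
pose F (t : T) := lin K (cf t.1) b *+ (n`! %/ t.2.+1).
have [] := @gap_between W' u [seq F t | t <- enum T & lower t]
  [seq F t | t <- enum T & ~~ lower t] u0.
  move=> _ _ /mapP[[f1 j1] + ->] /mapP[[f2 j2] + ->]; rewrite !mem_filter.
  move=> /andP[/asboolP /= l1 _] /andP[/asboolP /= l2 _].
  have fact_div (j : 'I_n) : (n`! %/ j.+1 * j.+1 = n`!)%N.
    by apply: divnK; apply: dvdn_fact; rewrite ltn_ord.
  have q0 (j : 'I_n) : (0 < n`! %/ j.+1)%N.
    by have := fact_gt0 n; rewrite -{1}(fact_div j) muln_gt0 => /andP[].
  have {}l2 : olt (x *+ j2.+1) (lin K (cf f2) a).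
    case: (olt_total (lin K (cf f2) a) (x *+ j2.+1)) => // e.
    by case: (hx j2.+1 (cf f2)); rewrite ?ltn_ord //; exact: cf_le.
  have h : olt (lin K (cf f1) a *+ (n`! %/ j1.+1)) (lin K (cf f2) a *+ (n`! %/ j2.+1)).
    have E (j : 'I_n) : x *+ n`! = x *+ j.+1 *+ (n`! %/ j.+1).
      by rewrite -mulrnA mulnC fact_div.
    apply: (olt_trans (x *+ n`!)).
      by rewrite (E j1) !(pmulrn _ (_ %/ _)); apply/olt_mulrz => //; exact: q0.
    by rewrite (E j2) !(pmulrn _ (_ %/ _)); apply/olt_mulrz => //; exact: q0.
  move: h; rewrite /F /= /olt !pmulrn -!linZ -!linB => /hs; apply=> l.
  have qn (j : 'I_n) : (n`! %/ j.+1 <= n`!)%N by exact: leq_div.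
  have h (f : {ffun 'I_K -> 'I_(2 * n).+1}) (j : 'I_n) :
      `|cf f l * (n`! %/ j.+1)%N%:Z| <= n%:Z * (n`!)%:Z.
    by rewrite normrM; apply: ler_pM => //; exact: qn.
  apply: le_trans (ler_normB _ _) (le_trans (lerD (h f2 j2) (h f1 j1)) _).
  by rewrite /N; nia.
move=> y [y' [yy h1 h2]]; exists y, y'; split=> // j c j0 jn hc ci.
have [f hf] := cfE hc; have lt : (j.-1 < n)%N by lia.
have jE : j.-1.+1 = j by lia.
have linE (V : ogroup) (g : nat -> V) : lin K c g = lin K (cf f) g.
  by apply: lin_ext => // l lK; rewrite hf //=; case: eqP => [->|].
rewrite !linE -jE; split=> hl.
  apply: h1; apply/mapP; exists (f, Ordinal lt) => //.
  by rewrite mem_filter mem_enum andbT; apply/asboolP.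
apply: h2; apply/mapP; exists (f, Ordinal lt) => //.
rewrite mem_filter mem_enum andbT; apply/asboolP => /=; exact: olt_asym.
Qed.

Lemma agree_step (a : nat -> W) (b : nat -> W') x (u : W') : opos u -> agree K N a b ->
  exists y, agree K n [eta a with i |-> x] [eta b with i |-> y].
Proof.
move=> pu ag; case: (EM (exists j c, [/\ (0 < j)%N, (j <= n)%N,
    forall l, `|c l| <= n%:Z & x *+ j = lin K c a])) => [[j [c [j0 jn hc xj]]]|hx].
  exact: agree_step_algebraic ag j0 jn hc xj.
have nN : (n <= N)%N by rewrite /N; lia.
have {}hx j c : (0 < j)%N -> (j <= n)%N -> (forall l, `|c l| <= n%:Z) ->
    x *+ j <> lin K c a by move=> j0 jn hc e; apply: hx; exists j, c.
have [lo [hi [lohi hcut]]] := agree_step_cut ag hx pu.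
have [hs hr] := agree_le nN ag.
have [zs hzs] : {zs : nat -> W' & forall p, prime p -> (p <= n)%N ->
    forall y, divides (p ^ n) (y - zs p) ->
    same_residues K p n [eta a with i |-> x] [eta b with i |-> y]}.
  apply: (@choice _ _ (fun p (zp : W') => prime p -> (p <= n)%N -> forall y,
    divides (p ^ n) (y - zp) ->
    same_residues K p n [eta a with i |-> x] [eta b with i |-> y])) => p.
  case: (EM (prime p /\ (p <= n)%N)) => [[pp pn]|h]; last first.
    by exists 0 => pp pn; case: h.
  have [z hz] := same_residues_extend x pp iK (fun r g g' => dim_le pp) (hr p pp pn).
  by exists z.
have [] := @simultaneous_congruences W' [seq p <- iota 0 n.+1 | prime p] n zs.
- by rewrite filter_uniq // iota_uniq.
- exact: filter_all.
move=> z hz; pose M := (\prod_(p <- [seq p <- iota 0 n.+1 | prime p]) p ^ n)%N.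
have M0 : (0 < n`! * M)%N.
  rewrite muln_gt0 fact_gt0 /M big_filter; apply: prodn_cond_gt0 => p.
  by move=> /prime_gt0 p0; rewrite expn_gt0 p0.
(* With y = z + w M the residues of z are kept, and density of (n! M) W' allows n! y to be placed in
   the gap. *)
have [|w [w1 w2]] := W'_reg (x := lo - z *+ n`!) (y := hi - z *+ n`!) M0.
  by rewrite olt_add2r.
pose y := z + w *+ M; exists y.
have ylo : olt lo (y *+ n`!).
  by move: w1; rewrite /olt; congr opos; rewrite /y; zring.
have yhi : olt (y *+ n`!) hi.
  by move: w2; rewrite /olt; congr opos; rewrite /y; zring.
(* With d i positive, the sign is that of a comparison of j y with a combination, decided by the
   cut. Negative d i follow by negation, and for d i = 0 the new element does not occur. *)
have key d : (forall l, `|d l| <= n%:Z) -> 0 < d i ->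
    let A := lin K d [eta a with i |-> x] in
    let B := lin K d [eta b with i |-> y] in
    (opos A /\ opos B) \/ (opos (- A) /\ opos (- B)).
  move=> hd di /=; pose j := `|d i|%N; have hdi := hd i.
  have jE : d i = j%:Z by rewrite /j; lia.
  have j0 : (0 < j)%N by rewrite /j; lia.
  have jn : (j <= n)%N by rewrite /j; lia.
  pose c l := - [eta d with i |-> 0] l.
  have hc l : `|c l| <= n%:Z by rewrite /c /=; case: eqP => _; [lia|have := hd l; lia].
  have ci : c i = 0 by rewrite /c /= eqxx oppr0.
  have [h1 h2] := hcut j c j0 jn hc ci.
  have E (V : ogroup) (g : nat -> V) v : lin K d [eta g with i |-> v] = v *+ j - lin
    K c g.
    by rewrite lin_set // jE linN opprK addrC.
  have qE : (n`! = j * (n`! %/ j))%N by rewrite mulnC divnK // dvdn_fact // j0.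
  have q0 : 0 < (n`! %/ j)%N%:Z by have := fact_gt0 n;
    rewrite {1}qE muln_gt0 => /andP[].
  rewrite !E !opprB; case: (olt_total (lin K c a) (x *+ j)) => h.
  - left; split=> //; rewrite -/(olt _ _); apply/(olt_mulrz _ _ q0).
    apply: ole_lt_trans (h1 h) _; move: ylo; rewrite {1}qE mulrnA; congr olt.
  - by case: (hx j c j0 jn hc).
  - right; split=> //; rewrite -/(olt _ _); apply/(olt_mulrz _ _ q0).
    apply: olt_le_trans (h2 h); move: yhi; rewrite {1}qE mulrnA; congr olt.
split=> [d hd|p pp pn]; last first.
  apply: hzs => //; rewrite /y addrAC; apply: dividesD.
    by apply: hz; rewrite mem_filter pp mem_iota.
  exists (w *+ (M %/ p ^ n)); rewrite -mulrnA divnK //.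
  have pin : p \in [seq p <- iota 0 n.+1 | prime p] by rewrite mem_filter pp mem_iota.
  by rewrite /M (big_rem p) //= dvdn_mulr.
have [d0|d0|d0] := ltgtP (d i) 0.
- have hd' l : `|- d l| <= n%:Z by rewrite normrN.
  have := key (fun l => - d l) hd'; rewrite oppr_gt0 => /(_ d0) /=;
    rewrite !linN !opprK.
  by case=> -[h1 h2]; split=> // h3; case: (opos_asym h3).
- have := key d hd d0 => /=.
  by case=> -[h1 h2]; split=> // h3; case: (opos_asym h3).
- rewrite !lin_set // d0 !mulr0z !addr0; apply: hs => l /=.
  by case: eqP => // _; rewrite normr0.
Qed.
End Step.

(** * From agreeing tuples to formulas *)

Lemma ole_mulrz (W : ogroup) (x y : W) k : 0 <= k -> ole x y -> ole (x *~ k) (y *~ k).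
Proof.
move=> k0 [xy|->]; last exact: ole_refl.
have [->|nk] := eqVneq k 0; first by rewrite !mulr0z; exact: ole_refl.
by left; apply/olt_mulrz => //; rewrite lt_neqAle eq_sym nk.
Qed.

Lemma ole_add (W : ogroup) (x y x' y' : W) : ole x y -> ole x' y' -> ole (x + x') (y
  + y').
Proof.
move=> h1 h2; apply: (ole_trans (y + x')); first by rewrite ole_add2r.
by rewrite ole_add2l.
Qed.

(** Limits the number of turns by which the value of a term can leave [0, u[. *)
Lemma lin_le (W : ogroup) (u : W) K (B : nat) c (a : nat -> W) : opos u ->
  (forall i, (i < K)%N -> ole 0 (a i) /\ ole (a i) u) ->
  (forall i, `|c i| <= B%:Z) -> ole (lin K c a) (u *~ (K * B)%N).
Proof.
move=> pu; elim: K => [|K IH] ha hc; first by rewrite lin0 mul0n mulr0z;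
  exact: ole_refl.
rewrite linS mulSn addnC PoszD mulrzDr; apply: ole_add.
  by apply: IH => // i iK; apply: ha; exact: ltnW.
have [a0 au] := ha K (leqnn _); have hcK := hc K.
apply: (ole_trans (u *~ `|c K|)); last first.
  have [->|ne] := eqVneq `|c K| B%:Z; first exact: ole_refl.
  by left; apply/olt_mulrzr; rewrite // lt_neqAle ne.
have [c0|c0] := leP 0 (c K); first by rewrite ger0_norm //; exact: ole_mulrz.
rewrite ltr0_norm //; apply: (ole_trans 0).
  have := ole_mulrz (k := - c K) _ a0; rewrite mul0rz mulrNz => h.
  by rewrite -(ole_add2r (- (a K *~ c K))) subrr add0r; apply: h; rewrite oppr_ge0 ltW.
rewrite -(mul0rz _ (- c K)); apply: ole_mulrz; first by rewrite oppr_ge0 ltW.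
by left; rewrite olt0.
Qed.

Fixpoint term_coef (t : co_term) : nat -> int :=
  match t with
  | TVar i => fun j => if j == i.+1 then 1 else 0
  | TZero => fun=> 0
  | TOpp t1 => fun j => - term_coef t1 j
  | TAdd t1 t2 => fun j => term_coef t1 j + term_coef t2 j
  end.

Fixpoint term_size (t : co_term) : nat :=
  match t with
  | TVar i => 1
  | TZero => 0
  | TOpp t1 => term_size t1
  | TAdd t1 t2 => term_size t1 + term_size t2
  end.

Lemma term_coef_le t j : `|term_coef t j| <= (term_size t)%:Z.
Proof. by elim: t => [i||t IH|t IH t' IH'] //=; [case: eqP|rewrite normrN|lia]. Qed.

(** Bound variables count as well, since each quantifier writes into a slot of the tuples. *)
Fixpoint all_vars (f : co_formula) : seq nat :=
  match f with
  | FEq t1 t2 => term_vars t1 ++ term_vars t2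
  | FCyc t1 t2 t3 => term_vars t1 ++ term_vars t2 ++ term_vars t3
  | FNot f1 => all_vars f1
  | FAnd f1 f2 => all_vars f1 ++ all_vars f2
  | FExists i f1 => i :: all_vars f1
  end.

(* Slot 0 of a is reserved for u; slot i + 1 lifts the value of variable i. *)
Definition lifts (G : coGroup) (U : unwinding G) K (a : nat -> U) (e : nat -> G) :=
  a 0%N = uu U /\ forall i, (i < K)%N ->
    [/\ ole 0 (a i.+1), olt (a i.+1) (uu U) & e i = upr U (a i.+1)].

Lemma eval_lifts (G : coGroup) (U : unwinding G) K a e t : lifts (U := U) K a e ->
  all (fun i => i < K)%N (term_vars t) ->
  eval_term e t = upr U (lin K.+1 (term_coef t) a).
Proof.
move=> [_ ha]; elim: t => [i||t IH|t IH t' IH'] /=.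
- by rewrite andbT => iK; rewrite lin_delta // mulr1z; have [] := ha _ iK.
- by rewrite /lin big1 ?raddf0 // => *; rewrite mulr0z.
- by move=> /IH ->; rewrite linN raddfN.
- by rewrite all_cat => /andP[/IH -> /IH' ->]; rewrite linD raddfD.
Qed.

Lemma lifts_set (G : coGroup) (U : unwinding G) K a e i (x : U) :
  lifts K a e -> ole 0 x -> olt x (uu U) ->
  lifts K [eta a with i.+1 |-> x] [eta e with i |-> upr U x].
Proof.
move=> [a0 ha] x0 xu; split=> //= j jK; rewrite eqSS; case: eqP => // _.
exact: ha.
Qed.

Section Transfer.
Variables (G H : coGroup) (U : unwinding G) (V : unwinding H).

Lemma agree_opos K n (a : nat -> U) (b : nat -> V) c d : agree K n a b ->
  (forall i, `|c i - d i| <= n%:Z) ->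
  (olt (lin K c a) (lin K d a) <-> olt (lin K c b) (lin K d b)).
Proof.
move=> [hs _] hcd; rewrite /olt -!linB; apply: hs => i.
by rewrite distrC.
Qed.

Lemma agree_eq K n (a : nat -> U) (b : nat -> V) c d : agree K n a b ->
  (forall i, `|c i - d i| <= n%:Z) ->
  (lin K c a = lin K d a <-> lin K c b = lin K d b).
Proof.
move=> ag hcd; split=> /eqP; rewrite -subr_eq0 -linB => /eqP h; apply/eqP;
  rewrite -subr_eq0 -linB; apply/eqP.
  exact: agree_lin0 ag hcd h.
exact: agree_lin0 (agree_sym ag) hcd h.
Qed.

(** The number k of turns made by the term is bounded by [lin_le], and comparing the term with k u
    and (k+1) u is a matter of signs, so k is the same on both sides. Subtracting k u only alters
    the coefficient of slot 0. *)
Lemma agree_reduce K (B : nat) n (a : nat -> U) (b : nat -> V) e e' c :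
  lifts K a e -> lifts K b e' -> agree K.+1 n a b ->
  (forall i, `|c i| <= B%:Z) -> (B + K.+1 * B + 2 <= n)%N ->
  exists d, [/\ forall i, `|d i| <= (B + K.+1 * B)%N%:Z,
    [/\ ole 0 (lin K.+1 d a), olt (lin K.+1 d a) (uu U)
      & upr U (lin K.+1 c a) = upr U (lin K.+1 d a)]
    & [/\ ole 0 (lin K.+1 d b), olt (lin K.+1 d b) (uu V)
      & upr V (lin K.+1 c b) = upr V (lin K.+1 d b)]].
Proof.
move=> [a0 ha] [b0 hb] ag hc hn.
have ha' i : (i < K.+1)%N -> ole 0 (a i) /\ ole (a i) (uu U).
  case: i => [_|i iK]; last by have [h1 h2 _] := ha i iK; split=> //; left.
  by rewrite a0; split; [left; rewrite olt0; exact: uu_pos|exact: ole_refl].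
have [k [k1 k2]] := ufloor (lin K.+1 c a).
have kle : `|k| <= (K.+1 * B)%:Z.
  have up := lin_le (uu_pos U) ha' hc.
  have := lin_le (c := fun i => - c i) (uu_pos U) ha' _.
  rewrite linN => lo; have {}lo : ole (- lin K.+1 c a) (uu U *~ (K.+1 * B)%N).
    by apply: lo => i; rewrite normrN.
  have h1 : k <= (K.+1 * B)%N.
    rewrite leNgt; apply/negP => h; have := (olt_mulrzr _ _ (uu_pos U)).2 h.
    by apply/oleNgt; exact: ole_trans up.
  have h2 : - (K.+1 * B)%N%:Z < k + 1.
    apply/(olt_mulrzr _ _ (uu_pos U)); apply: ole_lt_trans k2.
    by rewrite mulrNz -(ole_add2r (uu U *~ (K.+1 * B)%N)) addNr -(ole_add2l (- lin
      K.+1 c a)) addrA addNr add0r addr0.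
  lia.
pose del m (j : nat) : int := if j == 0%N then m else 0.
have delE (W : ogroup) (g : nat -> W) m : lin K.+1 (del m) g = g 0%N *~ m.
  exact: lin_delta.
exists (fun i => c i - del k i).
have dle i : `|c i - del k i| <= (B + K.+1 * B)%N%:Z.
  have := hc i; rewrite /del; case: eqP => _; lia.
split=> //; rewrite linB delE ?a0 ?b0; (split; last by rewrite raddfB upr_uM subr0).
- by rewrite -(ole_add2r (uu U *~ k)) add0r subrK.
- rewrite -(olt_add2r (uu U *~ k)) subrK.
  by have -> : uu U + uu U *~ k = uu U *~ (k + 1) by zring.
- rewrite -(ole_add2r (uu V *~ k)) add0r subrK -b0 -delE oleNgt => h.
  move: k1; rewrite -a0 -delE oleNgt; apply.
  by apply: (agree_opos ag _).2 h => i; have := dle i; lia.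
- rewrite -(olt_add2r (uu V *~ k)) subrK.
  have -> : uu V + uu V *~ k = uu V *~ (k + 1) by zring.
  rewrite -b0 -delE; move: k2; rewrite -a0 -delE => h.
  apply: (agree_opos ag _).1 h => i.
  by have := hc i; rewrite /del; case: eqP => _; lia.
Qed.

(** After reduction all values are representatives in [0, u[, where equality and R become sign
    conditions on differences; their coefficients are at most twice the reduced bound. *)
Lemma agree_atomic K B n t1 t2 t3 (a : nat -> U) (b : nat -> V) e e' :
  (term_size t1 <= B)%N -> (term_size t2 <= B)%N -> (term_size t3 <= B)%N ->
  (2 * (B + K.+1 * B) + 2 <= n)%N ->
  all (fun i => i < K)%N (term_vars t1 ++ term_vars t2 ++ term_vars t3) ->
  agree K.+1 n a b -> lifts K a e -> lifts K b e' ->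
  (eval_term e t1 = eval_term e t2 <-> eval_term e' t1 = eval_term e' t2) /\
  (cyc (eval_term e t1) (eval_term e t2) (eval_term e t3) <->
   cyc (eval_term e' t1) (eval_term e' t2) (eval_term e' t3)).
Proof.
rewrite !all_cat => s1 s2 s3 hn /and3P[v1 v2 v3] ag la lb.
have hB t i : (term_size t <= B)%N -> `|term_coef t i| <= B%:Z.
  by have := term_coef_le t i; lia.
have hn' : (B + K.+1 * B + 2 <= n)%N by apply: leq_trans hn;
  rewrite leq_add2r mul2n -addnn leq_addr.
have [d1 [h1 [p1 q1 r1] [p1' q1' r1']]] := agree_reduce la lb ag (fun i => hB t1 i
  s1) hn'.
have [d2 [h2 [p2 q2 r2] [p2' q2' r2']]] := agree_reduce la lb ag (fun i => hB t2 i
  s2) hn'.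
have [d3 [h3 [p3 q3 r3] [p3' q3' r3']]] := agree_reduce la lb ag (fun i => hB t3 i
  s3) hn'.
rewrite !(eval_lifts la) // !(eval_lifts lb) // r1 r2 r3 r1' r2' r3'.
have hd (d d' : nat -> int) : (forall i, `|d i| <= (B + K.+1 * B)%N%:Z) -> (forall i,
  `|d' i| <= (B + K.+1 * B)%N%:Z) ->
    forall i, `|d i - d' i| <= n%:Z.
  by move=> g g' i; have := g i; have := g' i; move: hn; lia.
split.
  have E := agree_eq ag (hd _ _ h1 h2).
  by split=> [/(upr_inj p1 q1 p2 q2)/E->|/(upr_inj p1' q1' p2' q2')/E->].
rewrite !upr_cyc //; have e12 := propext (agree_opos ag (hd _ _ h1 h2)).
have e23 := propext (agree_opos ag (hd _ _ h2 h3)).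
have e31 := propext (agree_opos ag (hd _ _ h3 h1)).
by rewrite e12 e23 e31.
Qed.
End Transfer.

Definition same_invariants (G H : coGroup) (U : unwinding G) (V : unwinding H) :=
  (forall p m, prime p -> incongruent_family G p m <-> incongruent_family H p m) /\
  (forall m, (0 < m)%N -> divides m (uu U) <-> divides m (uu V)).

Lemma same_invariants_sym (G H : coGroup) (U : unwinding G) (V : unwinding H) :
  same_invariants U V -> same_invariants V U.
Proof. by move=> [h1 h2]; split=> *; apply: iff_sym; auto. Qed.

Section FormulaTransfer.
Variables (G H : coGroup) (U : unwinding G) (V : unwinding H).

(** Lying in [0, u[ is a pair of sign conditions with coefficients of absolute value at most 1,
    which [n.+1] permits. So the partner of a lift is again a lift. *)
Lemma agree_fund K n (a : nat -> U) (b : nat -> V) l : agree K n.+1 a b ->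
  (0 < l)%N -> (l < K)%N -> a 0%N = uu U -> b 0%N = uu V ->
  ole 0 (a l) -> olt (a l) (uu U) -> ole 0 (b l) /\ olt (b l) (uu V).
Proof.
move=> ag l0 lK a0 b0; have K0 : (0 < K)%N by exact: leq_ltn_trans lK.
pose del (m j : nat) : int := if j == m then 1 else 0.
have E (W : ogroup) (c : nat -> W) m : (m < K)%N -> c m = lin K (del m) c.
  by move=> mK; rewrite lin_delta // mulr1z.
have Z (W : ogroup) (c : nat -> W) : 0 = lin K (fun=> 0) c.
  by rewrite /lin big1 // => *; rewrite mulr0z.
rewrite !oleNgt -a0 -b0 (E _ a l) // (E _ b l) // (E _ a 0%N) // (E _ b 0%N) //.
rewrite (Z _ a) (Z _ b) => h1 h2; split.
  by move=> h; apply: h1; apply: (agree_opos ag _).2 h => i; rewrite /del subr0;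
    case: eqP.
apply: (agree_opos ag _).1 h2 => i; rewrite /del.
by case: eqP => [->|_]; [rewrite eqn0Ngt l0|case: eqP].
Qed.

Lemma exists_transfer K n i f : regular_dense V -> same_invariants U V ->
  (i < K)%N ->
  (forall (a : nat -> U) (b : nat -> V) e e', agree K.+1 n.+1 a b ->
     lifts K a e -> lifts K b e' -> holds e f -> holds e' f) ->
  exists N, forall (a : nat -> U) (b : nat -> V) e e', agree K.+1 N a b ->
    lifts K a e -> lifts K b e' ->
    holds e (FExists i f) -> holds e' (FExists i f).
Proof.
move=> rV [hp hm] iK hf; eexists => a b e e' ag la lb [g hg].
have dim p r g0 g1 : prime p -> indep (A := U) p r.+1 g0 -> indep (A := V) p r g1 ->
    exists x, indep p r.+1 [eta g1 with r |-> x].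
  move=> pp; apply: (same_dimension pp) => [m|]; first exact: hp.
  exact: hm (prime_gt0 pp).
have iK1 : (i.+1 < K.+1)%N by [].
have [y hy] := agree_step rV dim (n := n.+1) iK1 (ulift U g) (uu_pos V) ag.
have [] := agree_fund hy (ltn0Sn i) iK1; rewrite /= ?eqxx.
- exact: la.1.
- exact: lb.1.
- exact: ulift_ge0.
- exact: ulift_lt.
move=> y0 yu; exists (upr V y);
  have lx := lifts_set i la (ulift_ge0 U g) (ulift_lt U g).
have ly := lifts_set i lb y0 yu.
by refine (hf _ _ _ _ hy lx ly _); rewrite uliftK.
Qed.
End FormulaTransfer.

Lemma formula_transfer (G H : coGroup) (U : unwinding G) (V : unwinding H) K f :
  regular_dense U -> regular_dense V -> same_invariants U V ->
  all (fun i => i < K)%N (all_vars f) ->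
  exists N, forall (a : nat -> U) (b : nat -> V) e e', agree K.+1 N a b ->
    lifts K a e -> lifts K b e' -> (holds e f <-> holds e' f).
Proof.
move=> rU rV hUV; elim: f => [t1 t2|t1 t2 t3|f IH|f IH f' IH'|i f IH] /= vf.
- pose B := (term_size t1 + term_size t2)%N.
  exists (2 * (B + K.+1 * B) + 2)%N => a b e e' ag la lb.
  have vf2 : all (fun i => i < K)%N (term_vars t1 ++ term_vars t2 ++ term_vars t2).
    by move: vf; rewrite !all_cat => /andP[-> ->].
  have [||||->] := agree_atomic (B := B) _ _ _ _ vf2 ag la lb => //; rewrite /B; lia.
- pose B := (term_size t1 + term_size t2 + term_size t3)%N.
  exists (2 * (B + K.+1 * B) + 2)%N => a b e e' ag la lb.
  have [||||_] := agree_atomic (B := B) _ _ _ _ vf ag la lb => //; rewrite /B; lia.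
- by have [N hN] := IH vf; exists N => a b e e' ag la lb;
  have := hN _ _ _ _ ag la lb; tauto.
- rewrite all_cat in vf; case/andP: vf => /IH [N hN] /IH' [N' hN'].
  exists (maxn N N') => a b e e' ag la lb.
  have := hN _ _ _ _ (agree_le (leq_maxl N N') ag) la lb.
  have := hN' _ _ _ _ (agree_le (leq_maxr N N') ag) la lb.
  tauto.
- case/andP: vf => iK /IH [n hn].
  have [|N1 h1] := @exists_transfer _ _ U V K n i f rV hUV iK.
    by move=> a b e e' ag la lb; apply: (hn _ _ _ _ (agree_le (leqnSn n) ag) la lb).1.
  have [|N2 h2] := @exists_transfer _ _ V U K n i f rU (same_invariants_sym hUV) iK.
    move=> a b e e' ag la lb.
    by apply: (hn _ _ _ _ (agree_sym (agree_le (leqnSn n) ag)) lb la).2.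
  exists (maxn N1 N2) => a b e e' ag la lb; split.
    exact: h1 (agree_le (leq_maxl N1 N2) ag) la lb.
  exact: h2 (agree_sym (agree_le (leq_maxr N1 N2) ag)) lb la.
Qed.

Lemma eval_term_ext (G : coGroup) (e e' : nat -> G) t :
  {in term_vars t, e =1 e'} -> eval_term e t = eval_term e' t.
Proof.
elim: t => [i|//|t IH|t IH t' IH'] /= h; first by apply: h; rewrite inE.
  by rewrite IH.
by rewrite IH ?IH' // => i it; apply: h; rewrite mem_cat it ?orbT.
Qed.

Lemma holds_ext (G : coGroup) (e e' : nat -> G) f :
  {in free_vars f, e =1 e'} -> holds e f <-> holds e' f.
Proof.
elim: f e e' => [t1 t2|t1 t2 t3|f IH|f IH f' IH'|i f IH] e e' /= h.
- by rewrite !(@eval_term_ext _ e e') // => i it; apply: h; rewrite mem_cat it ?orbT.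
- by rewrite !(@eval_term_ext _ e e') // => i it; apply: h; rewrite !mem_cat it ?orbT.
- by rewrite (IH e e').
- by rewrite (IH e e') ?(IH' e e') // => i it; apply: h; rewrite mem_cat it ?orbT.
- have ext x : holds [eta e with i |-> x] f <-> holds [eta e' with i |-> x] f.
    apply: IH => j jf /=; case: eqP => // /eqP ji; apply: h.
    by rewrite mem_filter ji.
  by split=> -[x hx]; exists x; apply/ext.
Qed.

Lemma sentence_holds (G : coGroup) f (e : nat -> G) : sentence f ->
  models G f <-> holds e f.
Proof.
move=> sf; split=> [|h e']; first exact.
by apply: (holds_ext _).1 h => i; rewrite sf.
Qed.

(** Only slot 0 matters. Write u = p^h v with h = n or v not divisible by p; equal divisors give the
    unit of V the same height h, and in the second case v and its partner v' are one-element
    independent families. *)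
Lemma agree_init (G H : coGroup) (U : unwinding G) (V : unwinding H) K n :
  same_invariants U V ->
  agree K.+1 n [eta (fun=> 0) with 0%N |-> uu U] [eta (fun=> 0) with 0%N |-> uu V].
Proof.
move=> [_ hm]; split=> [c _|p pp pn].
  rewrite !lin_set //; have E (W : ogroup) d : lin K.+1 d (fun=> 0 : W) = 0.
    by rewrite /lin big1 // => *; rewrite mul0rz.
  by rewrite !E !add0r !opos_mulrzr //; exact: uu_pos.
have ind0 (W : ogroup) (g : nat -> W) : indep p 0 g by [].
have [t [h [v [uE hv]]]] := indep_decomp (uu U) n pp (ind0 U (fun=> 0)).
have pp0 k : (0 < p ^ k)%N by rewrite expn_gt0 prime_gt0.
rewrite lin0 add0r in uE; have [v' uE'] : divides (p ^ h) (uu V).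
  by apply/hm => //; exists v.
case: hv => [he|[he iv]].
  exists 0%N, (fun=> 0), (fun=> 0), (fun _ _ => 0); split=> // i iK;
    rewrite lin0 subr0 /=.
    by case: eqP => _; [exists v; rewrite -he|exact: divides0].
  by case: eqP => _; [exists v'; rewrite -he|exact: divides0].
have nv' : ~ divides p v'.
  move=> [z hz]; have : divides (p ^ h.+1) (uu V) by exists z;
    rewrite uE' hz expnS mulrnA.
  move=> /(hm _ (pp0 _)); rewrite uE expnS => /divides_mulI => /(_ (pp0 _)) [y hy].
  have : (p %| (1 : int))%Z.
    by apply: (iv (fun=> 1) _ 0%N isT); rewrite lin_last lin0 add0r mulr1z; exists y.
  by rewrite dvdzE /= dvdn1 => /eqP p1; rewrite p1 in pp.
exists 1%N, [eta (fun=> 0) with 0%N |-> v], [eta (fun=> 0) with 0%N |-> v'],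
  (fun i _ => if i == 0%N then (p ^ h)%N%:Z else 0).
split=> //.
- apply: indep_extend => // -[c]; rewrite lin0 subr0; exact: nv'.
- move=> i iK; rewrite /lin big_ord1 /=; case: eqP => _.
    by rewrite -pmulrn -uE subrr; exact: divides0.
  by rewrite mulr0z subr0; exact: divides0.
- move=> i iK; rewrite /lin big_ord1 /=; case: eqP => _.
    by rewrite -pmulrn -uE' subrr; exact: divides0.
  by rewrite mulr0z subr0; exact: divides0.
Qed.

Lemma same_invariants_elem_equiv (G H : coGroup) (U : unwinding G) (V : unwinding H) :
  regular_dense U -> regular_dense V -> same_invariants U V -> elem_equiv G H.
Proof.
move=> rU rV hUV f sf;
  rewrite (sentence_holds (fun=> 0) sf) (sentence_holds (fun=> 0) sf).
pose K := (\max_(i <- all_vars f) i).+1.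
have vf : all (fun i => i < K)%N (all_vars f).
  by apply/allP => i iv; rewrite ltnS; exact: leq_bigmax_seq.
have [N hN] := formula_transfer rU rV hUV vf.
apply: hN (agree_init K N hUV) _ _; split=> //= i iK.
  by rewrite raddf0 olt0; split=> //; exact: uu_pos.
by rewrite raddf0 olt0; split=> //; exact: uu_pos.
Qed.

(** * First-order properties *)

(** Predicates are uniform in G, so that one formula serves both groups; the bound k on the free
    variables leaves variable k available for binding. *)
Definition definable k (P : forall G : coGroup, (nat -> G) -> Prop) :=
  exists f, all (fun i => i < k)%N (free_vars f) /\
    forall (G : coGroup) (e : nat -> G), holds e f <-> P G e.

Definition definable_term k (t : forall G : coGroup, (nat -> G) -> G) :=
  exists s, all (fun i => i < k)%N (term_vars s) /\
    forall (G : coGroup) (e : nat -> G), eval_term e s = t G e.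

Section Definability.
Implicit Types (P Q : forall G : coGroup, (nat -> G) -> Prop).
Implicit Types (s t : forall G : coGroup, (nat -> G) -> G).

Lemma definable_var k i : (i < k)%N -> definable_term k (fun G e => e i).
Proof. by move=> ik; exists (TVar i); rewrite /= ik. Qed.

Lemma definable_zero k : definable_term k (fun G e => 0).
Proof. by exists TZero. Qed.

Lemma definable_opp k t : definable_term k t -> definable_term k (fun G e => - t G e).
Proof. by move=> [s [vs hs]]; exists (TOpp s); split=> //= G e; rewrite hs. Qed.

Lemma definable_add k s t : definable_term k s -> definable_term k t ->
  definable_term k (fun G e => s G e + t G e).
Proof.
move=> [s' [vs hs]] [t' [vt ht]]; exists (TAdd s' t').
by split=> [|G e] /=; rewrite ?all_cat ?vs // hs ht.
Qed.

Lemma definable_muln k t n : definable_term k t -> definable_term k (fun G e => t G e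
  *+ n).
Proof.
move=> ht; elim: n => [|n [s [vs hs]]]; first exact: definable_zero.
have [t' [vt ht']] := ht; exists (TAdd t' s).
by split=> [|G e] /=; rewrite ?all_cat ?vs ?vt // hs ht' mulrS.
Qed.

Lemma definable_eq k s t : definable_term k s -> definable_term k t ->
  definable k (fun G e => s G e = t G e).
Proof.
move=> [s' [vs hs]] [t' [vt ht]]; exists (FEq s' t').
by split=> [|G e] /=; rewrite ?all_cat ?vs // hs ht.
Qed.

Lemma definable_cyc k s t u : definable_term k s -> definable_term k t ->
  definable_term k u -> definable k (fun G e => cyc (s G e) (t G e) (u G e)).
Proof.
move=> [s' [vs hs]] [t' [vt ht]] [u' [vu hu]]; exists (FCyc s' t' u').
by split=> [|G e] /=; rewrite ?all_cat ?vs ?vt // hs ht hu.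
Qed.

Lemma definable_iff k P Q : (forall G e, P G e <-> Q G e) -> definable k P ->
  definable k Q.
Proof. by move=> h [f [vf hf]]; exists f; split=> // G e; rewrite hf. Qed.

Lemma definable_not k P : definable k P -> definable k (fun G e => ~ P G e).
Proof. by move=> [f [vf hf]]; exists (FNot f); split=> //= G e; rewrite hf. Qed.

Lemma definable_and k P Q : definable k P -> definable k Q ->
  definable k (fun G e => P G e /\ Q G e).
Proof.
move=> [f [vf hf]] [g [vg hg]]; exists (FAnd f g).
by split=> [|G e] /=; rewrite ?all_cat ?vf // hf hg.
Qed.

Lemma definable_or k P Q : definable k P -> definable k Q ->
  definable k (fun G e => P G e \/ Q G e).
Proof.
move=> hP hQ; apply: (@definable_iff _ (fun G e => ~ (~ P G e /\ ~ Q G e))).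
  by move=> G e; split=> [/not_andP[]/contrapT h|[h|h] []//]; [left|right].
by apply/definable_not/definable_and; apply/definable_not.
Qed.

Lemma definable_bool k (b : bool) P : definable k P -> definable k (fun G e => b -> P
  G e).
Proof.
move=> hP; case: b.
  by apply: definable_iff hP => G e; split=> // h; apply: h.
apply: (@definable_iff _ (fun G e => (0 : G) = 0)) => [G e|]; first by split.
by apply: definable_eq; exact: definable_zero.
Qed.

Lemma definable_all k n (P : nat -> forall G : coGroup, (nat -> G) -> Prop) :
  (forall i, (i < n)%N -> definable k (P i)) ->
  definable k (fun G e => forall i, (i < n)%N -> P i G e).
Proof.
elim: n => [|n IH] hP.
  apply: (@definable_iff _ (fun G e => (0 : G) = 0)) => [G e|]; first by split.
  by apply: definable_eq; exact: definable_zero.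
apply: (@definable_iff _ (fun G e => (forall i, (i < n)%N -> P i G e) /\ P n G e)).
  move=> G e; split=> [[h1 h2] i|h].
    by rewrite ltnS leq_eqVlt => /orP[/eqP->|/h1].
  by split=> [i i_n|]; apply: h => //; exact: ltnW.
by apply: definable_and (IH _) (hP _ _) => // i i_n; apply: hP; exact: ltnW.
Qed.

Lemma definable_ex k P : definable k.+1 P ->
  definable k (fun G e => exists x, P G [eta e with k |-> x]).
Proof.
move=> [f [vf hf]]; exists (FExists k f); split=> [|G e] /=.
  apply/allP => i; rewrite mem_filter => /andP[ik /(allP vf)].
  by rewrite ltnS leq_eqVlt (negbTE ik).
by split=> -[x hx]; exists x; apply/hf.
Qed.

(** Only the values of the first k variables count, so quantifying over a whole valuation amounts to
    k quantifiers. *)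
Lemma definable_ex_all k P : definable k P -> definable 0 (fun G _ => exists e, P G e).
Proof.
elim: k P => [|k IH] P hP.
  have [f [vf hf]] := hP; exists f; split=> // G e; rewrite hf.
  split=> [h|[e' /hf h]]; first by exists e.
  by apply/hf/(holds_ext (e := e') (e' := e)) => // i /(allP vf).
apply: definable_iff (IH _ (definable_ex hP)) => G _; split=> [[e [x hx]]|[e he]].
  by exists [eta e with k |-> x].
exists e, (e k); congr (P G _): he; apply/funext => i /=.
by case: eqP => [->|].
Qed.

Lemma elem_equiv_definable (G H : coGroup) P (e : nat -> G) (e' : nat -> H) :
  elem_equiv G H -> definable 0 P -> P G e <-> P H e'.
Proof.
move=> GH [f [vf hf]]; have sf : sentence f.
  by rewrite /sentence; case: (free_vars f) vf.
by rewrite -!hf -!sentence_holds //; exact: GH.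
Qed.

Lemma definable_cyc_seq k n (t : nat -> forall G : coGroup, (nat -> G) -> G) :
  (forall i, (i < n)%N -> definable_term k (t i)) ->
  definable k (fun G e => cyc_seq (mkseq (fun i => t i G e) n)).
Proof.
move=> ht; apply: (@definable_iff _ (fun G e => forall i, (i < n)%N ->
    forall j, (j < n)%N -> forall l, (l < n)%N -> ((i < j) && (j < l))%N ->
    cyc (t i G e) (t j G e) (t l G e))).
  move=> G e; split=> [h i j l ij jl|h i i_n j jn l ln /andP[ij jl]].
    rewrite size_mkseq => ln; have jn := ltn_trans jl ln; have i_n := ltn_trans ij jn.
    by rewrite !nth_mkseq //; apply: h => //; rewrite ij.
  by have := h i j l ij jl; rewrite size_mkseq !nth_mkseq //; apply.
do 3 apply: definable_all => ? ?; apply: definable_bool.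
by apply: definable_cyc; exact: ht.
Qed.
End Definability.

Lemma elem_equiv_co_dense (G H : coGroup) : elem_equiv G H -> co_dense G -> co_dense H.
Proof.
pose P1 (G : coGroup) (e : nat -> G) := e 0%N <> 0.
pose P2 (G : coGroup) (e : nat -> G) := e 0%N <> e 1%N /\
  ~ exists c, cyc (e 0%N) c (e 1%N).
have d1 : definable 0 (fun G _ => exists e, P1 G e).
  apply: (@definable_ex_all 1); apply/definable_not/definable_eq.
    exact: definable_var.
  exact: definable_zero.
have d2 : definable 0 (fun G _ => exists e, P2 G e).
  apply: (@definable_ex_all 2); apply: definable_and; apply: definable_not.
    by apply: definable_eq; exact: definable_var.
  apply: (@definable_ex 2 (fun G e => cyc (e 0%N) (e 2%N) (e 1%N))).
  by apply: definable_cyc; exact: definable_var.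
move=> GH [[x x0] dG]; split.
  have [e he] : exists e, P1 H e.
    by apply: (elem_equiv_definable (fun=> 0) (fun=> 0) GH d1).1; exists (fun=> x).
  by exists (e 0%N).
move=> a b ab; apply: contrapT => hc.
have [e [e01 he]] : exists e, P2 G e.
  apply: (elem_equiv_definable (fun=> 0) (fun=> 0) GH d2).2.
  by exists (fun i => if i is 0%N then a else b).
by apply: he; exact: dG.
Qed.

Lemma elem_equiv_c_regular (G H : coGroup) : elem_equiv G H -> c_regular G ->
  c_regular H.
Proof.
move=> GH rG n n2; have n0 : (0 < n)%N by exact: ltnW.
pose Q (G : coGroup) (e : nat -> G) (y : G) :=
  ((y *+ n = e 0%N \/ y *+ n = e n.-1) \/ cyc (e 0%N) (y *+ n) (e n.-1)) /\
  cyc_seq (mkseq (fun i => if (i < n)%N then y *+ i else e n.-1) n.+1).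
(* A counterexample to c-n-regularity, stored in variables 0 to n-1; variable n is kept for the
   candidate y. *)
pose P (G : coGroup) (e : nat -> G) :=
  cyc_seq (mkseq (fun i => if i is j.+1 then e j else 0) n.+1) /\ ~ exists y, Q G e y.
have dP : definable 0 (fun G _ => exists e, P G e).
  apply: (@definable_ex_all n); apply: definable_and.
    apply: (@definable_cyc_seq _ _ (fun i G e => if i is j.+1 then e j else 0)) =>
      -[|i] hi.
      exact: definable_zero.
    exact: definable_var.
  apply/definable_not; have pn : (n.-1 < n.+1)%N by rewrite prednK // ltnW.
  apply: (@definable_iff _ (fun G e => exists y, Q G [eta e with n |-> y] ([eta e
    with n |-> y] n))).
    move=> K e; have E y : Q K [eta e with n |-> y] ([eta e with n |-> y] n) = Q K e y.
      by rewrite /Q /= eqxx !ltn_eqF // prednK.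
    by split=> -[y hy]; exists y; [rewrite -E|rewrite E].
  apply: (@definable_ex n (fun G e => Q G e (e n))).
  apply: definable_and.
    apply: definable_or; first apply: definable_or.
    + by apply: definable_eq; [apply: definable_muln|]; apply: definable_var; lia.
    + by apply: definable_eq; [apply: definable_muln|]; apply: definable_var; lia.
    + by apply: definable_cyc; [|apply: definable_muln|]; apply: definable_var; lia.
  apply: (@definable_cyc_seq _ _ (fun i G e => if (i < n)%N then e n *+ i else e
    n.-1)) => i hi.
  by case: (i < n)%N; [apply: definable_muln|]; exact: definable_var.
have E0 (K : coGroup) (x : n.-tuple K) :
    mkseq (fun i => if i is j.+1 then x`_j else 0) n.+1 = 0 :: x.
  apply: (@eq_from_nth _ 0) => [|i]; rewrite size_mkseq /= ?size_tuple // => hi.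
  by rewrite nth_mkseq //; case: i hi.
have E1 (K : coGroup) (y z : K) :
    mkseq (fun i => if (i < n)%N then y *+ i else z) n.+1 = rcons (mkseq (fun i => y
      *+ i) n) z.
  rewrite mkseqS ltnn; congr rcons; apply/eq_in_map => i.
  by rewrite mem_iota => /= ->.
move=> x hx; apply: contrapT => hy.
have [e [he hQ]] : exists e, P G e.
  apply: (elem_equiv_definable (fun=> 0) (fun=> 0) GH dP).2.
  exists (fun i => x`_i); split; first by rewrite E0.
  move=> [y [h1 h2]]; apply: hy; exists y; rewrite -E1; split=> //.
  by case: h1 => [[|]|]; [exact: Or31|exact: Or32|exact: Or33].
pose x' := mktuple (fun i : 'I_n => e i).
have xE i : (i < n)%N -> x'`_i = e i.
  by move=> hi; have := tnth_mktuple (fun i : 'I_n => e i) (Ordinal hi);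
    rewrite (tnth_nth 0).
have [|y [h1 h2]] := rG n n2 x'.
  rewrite -E0; move: he; congr cyc_seq; apply/eq_in_map => -[|i] //.
  by rewrite mem_iota /= => hi; rewrite xE.
apply: hQ; exists y; rewrite /Q E1 -!xE ?prednK //; split=> //.
by case: h1; auto.
Qed.

Definition has_order (G : zmodType) (m : nat) := exists x : G,
  x *+ m = 0 /\ forall k, (k < m)%N -> (0 < k)%N -> x *+ k <> 0.

Lemma elem_equiv_has_order (G H : coGroup) m : elem_equiv G H ->
  has_order G m <-> has_order H m.
Proof.
pose P (G : coGroup) (e : nat -> G) := e 0%N *+ m = 0 /\
  forall k, (k < m)%N -> (0 < k)%N -> e 0%N *+ k <> 0.
have dP : definable 0 (fun G _ => exists e, P G e).
  apply: (@definable_ex_all 1); apply: definable_and.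
    by apply: definable_eq; [apply: definable_muln;
      exact: definable_var|exact: definable_zero].
  apply: definable_all => k km; apply: definable_bool; apply: definable_not.
  by apply: definable_eq; [apply: definable_muln;
    exact: definable_var|exact: definable_zero].
have E (K : coGroup) : has_order K m <-> exists e, P K e.
  by split=> [[x hx]|[e he]]; [exists (fun=> x)|exists (e 0%N)].
by move=> GH; rewrite !E; exact: (elem_equiv_definable (fun=> 0) (fun=> 0) GH dP).
Qed.

Lemma elem_equiv_incongruent (G H : coGroup) p n : elem_equiv G H ->
  incongruent_family G p n <-> incongruent_family H p n.
Proof.
pose P (G : coGroup) (e : nat -> G) := forall i, (i < n)%N -> forall j, (j < n)%N ->
  i != j -> ~ exists z, e i - e j = z *+ p.
have dP : definable 0 (fun G _ => exists e, P G e).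
  apply: (@definable_ex_all n); apply: definable_all => i i_n.
  apply: definable_all => j jn; apply: definable_bool; apply: definable_not.
  apply: (@definable_iff _ (fun G e => exists z, [eta e with n |-> z] i - [eta e with
    n |-> z] j = [eta e with n |-> z] n *+ p)).
    by move=> K e /=; rewrite eqxx !ltn_eqF.
  apply: (@definable_ex n (fun G e => e i - e j = e n *+ p)); apply: definable_eq.
    by apply: definable_add; [|apply: definable_opp]; apply: definable_var; exact: ltnW.
  by apply: definable_muln; exact: definable_var.
have E (K : coGroup) : incongruent_family K p n <-> exists e, P K e.
  split=> [[u hu]|[e he]].
    exists (fun i => oapp u 0 (insub i)) => i i_n j jn ij.
    by rewrite !insubT /=; apply: hu; rewrite -val_eqE.
  by exists (fun i => e i) => i j ij; exact: he.
by move=> GH; rewrite !E; exact: (elem_equiv_definable (fun=> 0) (fun=> 0) GH dP).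
Qed.

(** * Torsion and prime invariants *)

Lemma divides_coprimez (A : zmodType) (m : nat) (k : int) (u w : A) :
  coprime m `|k| -> w *+ m = u *~ k -> divides m u.
Proof.
move=> cop wu; have /coprimezP [[s t] /= st] : coprimez m k by exact: cop.
rewrite -[u]mulr1z -st mulrzDr; apply: dividesD.
  by apply/divides_dvdz/dvdz_mull.
by rewrite mulrC mulrzA -wu; exists (w *~ t); zring.
Qed.

Lemma reduce_fraction (W : ogroup) (u w : W) m k : (0 < m)%N -> w *+ m = u *~ k ->
  exists m' k', [/\ (0 < m')%N, (m' %| m)%N, coprime m' `|k'| & w *+ m' = u *~ k'].
Proof.
move=> m0 wu; pose g := gcdn m `|k|%N.
have g0 : (0 < g)%N by rewrite gcdn_gt0 m0.
have gm : (g %| m)%N by exact: dvdn_gcdl.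
have gk : (g %| k)%Z by rewrite dvdzE; exact: dvdn_gcdr.
exists (m %/ g)%N, (k %/ g)%Z; split.
- by rewrite divn_gt0 // dvdn_leq.
- by apply/dvdnP; exists g; rewrite mulnC divnK.
- rewrite /coprime -(eqn_pmul2l g0) muln1 muln_gcdr mulnC divnK //.
  have -> : (g * `|(k %/ g)%Z| = `|k|)%N by rewrite -{2}(divzK gk) abszM mulnC.
  by [].
have gz : (g%:Z != 0) by lia.
by apply: (omulrzI gz) => /=; rewrite -pmulrn -mulrnA divnK // wu -mulrzA divzK.
Qed.

(** The lift of an element of order m satisfies m w = k u. A common factor of m and k could be
    cancelled in the torsion-free W and would lower the order, so m and k are coprime and m divides
    u. Conversely the class of u / m has order m. *)
Lemma has_order_divides (G : coGroup) (U : unwinding G) m : (0 < m)%N ->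
  has_order G m <-> divides m (uu U).
Proof.
move=> m0; split=> [[x [xm xk]]|[w hw]].
  have [k hk] : exists k, ulift U x *+ m = uu U *~ k.
    by apply: upr_ker; rewrite raddfMn /= uliftK.
  have [m' [k' [m'0 m'm cop hk']]] := reduce_fraction m0 hk.
  have -> : m = m'; last exact: divides_coprimez cop hk'.
  apply/eqP; rewrite eqn_leq (dvdn_leq m0 m'm) andbT leqNgt; apply/negP => lt.
  by apply: (xk _ lt m'0); rewrite -[x](uliftK U) -raddfMn hk' upr_uM.
exists (upr U w); split=> [|k km k0]; first by rewrite -raddfMn -hw upr_uu.
rewrite -raddfMn => /upr_ker [l hl].
have pw : opos w.
  by apply/(@opos_mulrz _ m); rewrite -?pmulrn -?hw; [lia|exact: uu_pos].
have : w *~ k = w *~ (m%:Z * l) by rewrite -pmulrn hl hw mulrzA -pmulrn.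
move/eqP; rewrite -subr_eq0 -mulrzBr => /eqP h.
have h1 := (opos_mulrzr (k%:Z - m%:Z * l) pw).2; rewrite h in h1.
have h2 := (opos_mulrzr (- (k%:Z - m%:Z * l)) pw).2; rewrite mulrNz h oppr0 in h2.
have e : k%:Z - m%:Z * l = 0.
  case: (ltgtP (k%:Z - m%:Z * l) 0) => // c; last by case: (opos0 (h1 c)).
  by case: (opos0 (h2 _)); rewrite oppr_gt0.
by have [l0|l0|l0] := ltgtP l 0; nia.
Qed.

Lemma torsion_iso_has_order (G H : zmodType) m : (0 < m)%N ->
  torsion_isomorphic G H -> has_order G m <-> has_order H m.
Proof.
move=> m0 [f [[fT finj fsurj] fD]].
have T0 : torsion (0 : G) by exists 1%N.
have f0 : f 0 = 0 by apply: (addrI (f 0)); rewrite -fD // !addr0.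
have fM x : torsion x -> forall k, torsion (x *+ k) /\ f (x *+ k) = f x *+ k.
  move=> tx; elim=> [|k [IH1 IH2]]; first by rewrite !mulr0n.
  split; last by rewrite !mulrS fD // IH2.
  have [n n0 xn] := tx; exists n => //; rewrite -mulrnA mulnC mulrnA xn mul0rn //.
have f_eq0 x k : torsion x -> f x *+ k = 0 <-> x *+ k = 0.
  move=> tx; have [tk <-] := fM _ tx k; split=> [h|-> //].
  by apply: finj; rewrite ?inE // f0.
split=> [[x [xm xk]]|[y [ym yk]]].
  have tx : torsion x by exists m.
  by exists (f x); split=> [|k km k0]; rewrite f_eq0 //; exact: xk.
have ty : torsion y by exists m.
have [x tx xy] := fsurj _ ty; exists x.
by split=> [|k km k0]; rewrite -f_eq0 // xy //; exact: yk.
Qed.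

(* x and y are the classes of k/m times the units of U and V. *)
Definition same_angle (G H : coGroup) (U : unwinding G) (V : unwinding H)
  (x : G) (y : H) := exists (w : U) (w' : V) (m : nat) (k : int),
  [/\ (0 < m)%N, upr U w = x, upr V w' = y, w *+ m = uu U *~ k & w' *+ m = uu V *~ k].

Section SameAngle.
Variables (G H : coGroup) (U : unwinding G) (V : unwinding H).
Notation same_angle := (same_angle U V).

Lemma same_angle_ex x :
  (forall m, (0 < m)%N -> divides m (uu U) <-> divides m (uu V)) ->
  torsion x -> exists y, same_angle x y.
Proof.
move=> hm [m m0 xm]; have [k hk] : exists k, ulift U x *+ m = uu U *~ k.
  by apply: upr_ker; rewrite raddfMn /= uliftK.
have [m' [k' [m'0 m'm cop hk']]] := reduce_fraction m0 hk.
have [v hv] : divides m' (uu V) by apply/hm => //; exact: divides_coprimez cop hk'.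
exists (upr V (v *~ k')), (ulift U x), (v *~ k'), m', k'; split=> //.
  exact: uliftK.
by rewrite hv; zring.
Qed.

Lemma same_angleD x x' y y' : same_angle x y -> same_angle x' y' ->
  same_angle (x + x') (y + y').
Proof.
move=> [w1 [w1' [m1 [k1 [m10 <- <- h1 h1']]]]] [w2 [w2' [m2 [k2 [m20 <- <- h2 h2']]]]].
exists (w1 + w2), (w1' + w2'), (m1 * m2)%N, (k1 * m2%:Z + k2 * m1%:Z).
rewrite !raddfD; split=> //; first by rewrite muln_gt0 m10.
  transitivity (w1 *+ m1 *+ m2 + w2 *+ m2 *+ m1); first by zring.
  by rewrite h1 h2; zring.
transitivity (w1' *+ m1 *+ m2 + w2' *+ m2 *+ m1); first by zring.
by rewrite h1' h2'; zring.
Qed.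

Lemma same_angle0 y : same_angle 0 y -> y = 0.
Proof.
move=> [w [w' [m [k [m0 /upr_ker [l hl] <- h h']]]]].
have mz : (m%:Z != 0) by lia.
have e : uu U *~ (l * m%:Z - k) = 0.
  by rewrite mulrzBr -h hl; zring.
have {}e : k = l * m%:Z.
  apply/eqP; rewrite eq_sym -subr_eq0; apply/eqP; apply: contrapT => /eqP ne.
  by have := uu_pos U; rewrite (otorsion_free ne e) => /opos0.
suff -> : w' = uu V *~ l by rewrite upr_uM.
by apply: (omulrzI mz) => /=; rewrite -pmulrn h' e mulrzA.
Qed.

Lemma same_angleN x y : same_angle x y -> same_angle (- x) (- y).
Proof.
move=> [w [w' [m [k [m0 <- <- h h']]]]]; exists (- w), (- w'), m, (- k).
by rewrite !raddfN; split=> //; rewrite mulNrn ?h ?h' ?mulrNz.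
Qed.

Lemma same_angle_torsion x y : same_angle x y -> torsion y.
Proof.
move=> [w [w' [m [k [m0 _ <- _ h]]]]]; exists m => //.
by rewrite -raddfMn h upr_uM.
Qed.

Lemma same_angle_uniq x y y' : same_angle x y -> same_angle x y' -> y = y'.
Proof.
move=> h1 /same_angleN h2; apply/eqP; rewrite -subr_eq0; apply/eqP.
by apply: same_angle0; rewrite -(subrr x); exact: same_angleD.
Qed.

End SameAngle.

Lemma same_angle_sym (G H : coGroup) (U : unwinding G) (V : unwinding H) x y :
  same_angle U V x y -> same_angle V U y x.
Proof. by move=> [w [w' [m [k []]]]]; exists w', w, m, k. Qed.

(** Torsion elements are the classes of the rational multiples of u lying in W. Equal divisors of
    the two units make the same fractions available on both sides, and matching equal fractions is
    the isomorphism. *)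
Lemma divides_torsion_iso (G H : coGroup) (U : unwinding G) (V : unwinding H) :
  (forall m, (0 < m)%N -> divides m (uu U) <-> divides m (uu V)) ->
  torsion_isomorphic G H.
Proof.
move=> hm; have [f hf] : {f : G -> H & forall x, torsion x -> same_angle U V x (f x)}.
  apply: (@choice _ _ (fun x y => torsion x -> same_angle U V x y)) => x.
  case: (EM (torsion x)) => [/(same_angle_ex hm) [y hy]|nt]; first by exists y.
  by exists 0.
exists f; split.
  split=> [x tx|x x'|y ty].
  - exact: same_angle_torsion (hf x tx).
  - rewrite !inE => tx tx' ff; apply: (same_angle_uniq (same_angle_sym (hf _ tx))).
    by rewrite ff; exact: same_angle_sym (hf _ tx').
  - have hm' m : (0 < m)%N -> divides m (uu V) <-> divides m (uu U).
      by move=> m0; apply: iff_sym; exact: hm.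
    have [x yx] := same_angle_ex hm' ty; have tx := same_angle_torsion yx.
    by exists x => //; apply: same_angle_uniq (hf _ tx) (same_angle_sym yx).
move=> x y tx ty; have txy : torsion (x + y).
  have [m m0 xm] := tx; have [n n0 yn] := ty; exists (m * n)%N;
    first by rewrite muln_gt0 m0.
  by rewrite mulrnDl mulrnA xm mul0rn mulnC mulrnA yn mul0rn addr0.
by apply: same_angle_uniq (hf _ txy) _; apply: same_angleD; exact: hf.
Qed.

(** Subfamilies of incongruent families are incongruent, so the possible sizes form an initial
    segment, determined by its greatest element or by being everything. *)
Lemma zakon_incongruent (G H : zmodType) p :
  zakon_invariant G p = zakon_invariant H p <->
  forall n, incongruent_family G p n <-> incongruent_family H p n.
Proof.
have key (A : zmodType) : (if zakon_invariant A p is Some n then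
    forall m, incongruent_family A p m <-> (m <= n)%N
    else forall m, incongruent_family A p m) : Prop.
  rewrite /zakon_invariant; case: xgetP => [o _ [n [-> hn hmax]]|h].
    by move=> m; split=> [/hmax //|mn]; exact: incongruent_le mn hn.
  elim=> [|m IH]; first by exists (fun=> 0) => -[].
  apply: contrapT => nm; apply: (h (Some m)); exists m; split=> // k hk.
  by rewrite leqNgt; apply/negP => mk; apply: nm; exact: incongruent_le mk hk.
split=> [e n|h].
  by have := key G; have := key H; rewrite e;
    case: (zakon_invariant H p) => [k|] h1 h2; [rewrite h1 h2|split].
have := key G; have := key H; case: (zakon_invariant G p) => [k|];
  case: (zakon_invariant H p) => [l|] //.
- move=> h1 h2; congr Some; apply/eqP; rewrite eqn_leq; apply/andP; split.
    by apply/h1/h/h2.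
  by apply/h2/h/h1.
- by move=> h1 /(_ k.+1); rewrite h => -[/(_ (h1 _))]; rewrite ?ltnn // => h2.
- by move=> /(_ l.+1) h1 h2; move: h1; rewrite -h => -[/(_ (h2 _))]; rewrite ltnn.
Qed.

(** * Subgroups of the circle *)

Section Circle.
Variable R : realType.
Implicit Types (s t : R) (z : R[i]).

Lemma expiD s t : expi (s + t) = expi s * expi t.
Proof. by rewrite /expi cosD sinD; simpc; rewrite [cos s * sin t + _]addrC. Qed.

Lemma expi0 : expi 0 = 1 :> R[i].
Proof. by rewrite /expi cos0 sin0. Qed.

Lemma expi2pi : expi (2 * pi) = 1 :> R[i].
Proof. by rewrite /expi mulr_natl cos2pi sin2pi. Qed.

Lemma expiN t : expi (- t) = (expi t)^-1.
Proof.
have h : expi (- t) * expi t = 1 by rewrite -expiD addNr expi0.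
have ne : expi t != 0.
  by apply/eqP => e; move/eqP: h; rewrite e mulr0 eq_sym oner_eq0.
by apply: (mulIf ne); rewrite h mulVf.
Qed.

Lemma expi_norm t : `|expi t| = 1.
Proof. by rewrite normc_def /= cos2Dsin2 sqrtr1. Qed.

Lemma expi_eq1 t : 0 <= t < 2 * pi -> expi t = 1 -> t = 0.
Proof.
move=> /andP[t0 tpi] [c1 s0]; apply/eqP; apply: contraT => tn.
have tp : 0 < t by rewrite lt_neqAle eq_sym tn.
(* By the half-angle formula cos t = 1 - 2 sin(t/2)^2, which would be less than 1. *)
have h : 0 < sin (t / 2) by apply: sin_gt0_pi; lra.
have e : t = t / 2 + t / 2 by lra.
have := c1; rewrite {1}e cosD; have := cos2Dsin2 (t / 2); nra.
Qed.

Lemma expi_inj s t : 0 <= s < 2 * pi -> 0 <= t < 2 * pi -> expi s = expi t -> s = t.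
Proof.
wlog st : s t / s <= t.
  move=> w hs ht e; have [le|/ltW le] := leP s t; first exact: w.
  by apply: esym; apply: w.
move=> hs ht e; apply/esym/eqP; rewrite -subr_eq0; apply/eqP; apply: expi_eq1;
  first lra.
rewrite expiD expiN e mulfV //; apply/eqP => e0.
by have := expi_norm t; rewrite e0 normr0 => /eqP; rewrite eq_sym oner_eq0.
Qed.

Lemma expi_surj z : `|z| = 1 -> exists2 t, 0 <= t < 2 * pi & z = expi t.
Proof.
case: z => a b; rewrite normc_def /= => /eqP;
  rewrite eq_complex /= eqxx andbT => /eqP h.
have ab : a ^+ 2 + b ^+ 2 = 1.
  by rewrite -[LHS]sqr_sqrtr ?h ?expr1n // addr_ge0 // sqr_ge0.
have a1 : -1 <= a <= 1 by have := sqr_ge0 b; nra.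
have ca : cos (acos a) = a by apply: acosK; rewrite in_itv.
have pi0 := pi_gt0 R; have ac0 := acos_ge0 a1; have acpi := acos_lepi a1.
have s0 : 0 <= sin (acos a) by apply: sin_ge0_pi; rewrite ac0.
have sb : sin (acos a) ^+ 2 = b ^+ 2 by rewrite sin2cos2 ca; lra.
have [b0|b0] := leP 0 b.
  exists (acos a); first by lra.
  by rewrite /expi ca; congr Complex; nra.
have sE : sin (acos a) = - b by nra.
have acn0 : acos a != 0 by apply/eqP => e; move: sE; rewrite e sin0; lra.
have {}ac0 : 0 < acos a by rewrite lt_neqAle eq_sym acn0.
exists (2 * pi - acos a); first by lra.
by rewrite /expi cosB sinB mulr_natl cos2pi sin2pi ca sE; congr Complex; lra.
Qed.

Definition cyc3 (a b c : R) := [\/ a < b < c, b < c < a | c < a < b].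

Lemma circle_cyc_expi r s t : 0 <= r < 2 * pi -> 0 <= s < 2 * pi -> 0 <= t < 2 * pi ->
  circle_cyc (expi r) (expi s) (expi t) <-> cyc3 r s t.
Proof.
move=> hr hs ht; split=> [[r' [s' [t' [[hr' hs' ht'] [[er es et] h]]]]]|h].
  by rewrite (expi_inj hr hr' er) (expi_inj hs hs' es) (expi_inj ht ht' et).
by exists r, s, t.
Qed.

(* t lists the arguments in [0, 2 pi[ of the values of a character. *)
Definition angle_map (A : zmodType) (t : A -> R) :=
  [/\ forall x, 0 <= t x < 2 * pi,
      forall x y, t (x + y) = t x + t y \/ t (x + y) = t x + t y - 2 * pi
    & injective t].

Lemma angle_map_cyclic_order (A : zmodType) (t : A -> R) : angle_map t ->
  cyclic_order (fun a b c => cyc3 (t a) (t b) (t c)).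
Proof.
move=> [t0 tD tI]; split=> [a b c h|a b c h|c|a b c u h].
- by split=> e; subst; case: h; rewrite ?ltxx ?andbF // => /andP[h1 h2];
  have := lt_trans h1 h2; rewrite ltxx.
- by case: h => h; [apply: Or33|apply: Or31|apply: Or32].
- split=> [x _|x y z _ _ _|x y /= xc yc].
  + by case=> h; lra.
  + case=> /andP[h1 h2] [] /andP[h3 h4];
      do [by apply: Or31; lra|by apply: Or32; lra|by apply: Or33; lra|lra].
  + have {xc}xc : t x != t c by apply/eqP => /tI.
    have {yc}yc : t y != t c by apply/eqP => /tI.
    have [xy|xy|/tI xy] := ltgtP (t x) (t y); last exact: Or32.
    * have [cx|cx|e] := ltgtP (t c) (t x); [|have [cy|cy|e] := ltgtP (t c) (t y)|].
      - by apply: Or31; apply: Or31; rewrite cx.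
      - by apply: Or33; apply: Or33; rewrite cx.
      - by apply: Or31; apply: Or32; rewrite xy.
      - by rewrite e eqxx in yc.
      - by rewrite e eqxx in xc.
    * have [cx|cx|e] := ltgtP (t c) (t y); [|have [cy|cy|e] := ltgtP (t c) (t x)|].
      - by apply: Or33; apply: Or31; rewrite cx.
      - by apply: Or31; apply: Or33; rewrite cx.
      - by apply: Or33; apply: Or32; rewrite xy.
      - by rewrite e eqxx in xc.
      - by rewrite e eqxx in yc.
- have := t0 a; have := t0 b; have := t0 c; have := t0 u.
  have := t0 (a + u); have := t0 (b + u); have := t0 (c + u).
  by case: (tD a u) => ->; case: (tD b u) => ->; case: (tD c u) => ->;
    move=> *; case: h => h; do [by apply: Or31; lra|by apply: Or32;
      lra|by apply: Or33; lra|lra].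
Qed.

Lemma c_archimedean_angle (A : coGroup) : c_archimedean R A ->
  exists t : A -> R, angle_map t /\ forall a b c : A, cyc a b c <-> cyc3 (t a) (t b)
    (t c).
Proof.
move=> [S [f [[Sc S1 SM SV] [fS finj _] fM fcyc]]].
have hf x : exists t, 0 <= t < 2 * pi /\ f x = expi t.
  by have [t t0 ->] := expi_surj (Sc _ (fS x I)); exists t.
have [t ht] := choice hf; exists t; split.
  split=> [x|x y|x y e]; first by have [] := ht x.
    have [hx fx] := ht x; have [hy fy] := ht y; have [hxy fxy] := ht (x + y).
    rewrite fM fx fy -expiD in fxy.
    have [le|le] := ltP (t x + t y) (2 * pi).
      by left; apply: esym; apply: expi_inj fxy => //; lra.
    right; apply: expi_inj => //; first lra.
    by rewrite expiD expiN expi2pi invr1 mulr1.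
  by apply: finj; rewrite ?inE // (ht x).2 e -(ht y).2.
move=> a b c; rewrite fcyc (ht a).2 (ht b).2 (ht c).2.
by apply: circle_cyc_expi; [have [] := ht a|have [] := ht b|have [] := ht c].
Qed.
End Circle.

(** * Archimedean ordered groups *)

Definition archimedean (W : ogroup) := forall x y : W, opos x -> exists n, olt y (x
  *+ n).

Section Archimedean.
Variable W : ogroup.
Hypothesis arch : archimedean W.
Implicit Types x y z d : W.

Lemma arch_floor d x : opos d -> exists k, ole (d *~ k) x /\ olt x (d *~ (k + 1)).
Proof.
move=> d0; have [m hm] := arch (- x) d0.
have [n0 hn0] := arch (x + d *+ m) d0.
have ex : exists n, `[< olt (x + d *+ m) (d *+ n) >] by exists n0; apply/asboolP.
case: (ex_minnP ex) => n /asboolP hn nmin.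
have n_gt0 : (0 < n)%N.
  rewrite lt0n; apply/eqP => n0'; move: hn; rewrite n0' mulr0n; apply: olt_asym.
  by rewrite -(olt_add2l (- x)) addr0 addrA addNr add0r.
exists (n%:Z - m%:Z - 1); split.
  rewrite -(ole_add2r (d *+ m)).
  have -> : d *~ (n%:Z - m%:Z - 1) + d *+ m = d *~ (n%:Z - 1) by zring.
  have -> : n%:Z - 1 = n.-1%:Z by lia.
  apply/oleNgt => h; have := nmin n.-1; rewrite leqNgt prednK // leqnn.
  by move=> /(_ _)/negP; apply => //; apply/asboolP.
rewrite -(olt_add2r (d *+ m)).
by have -> : d *~ (n%:Z - m%:Z - 1 + 1) + d *+ m = d *+ n by zring.
Qed.

Lemma dense_small n x : (forall x, opos x -> exists y, opos y /\ olt y x) ->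
  opos x -> exists y, opos y /\ olt (y *+ n) x.
Proof.
move=> dens x0; elim: n => [|n [y [y0 yx]]]; first by exists x; rewrite mulr0n olt0.
have [z [z0 zy]] := dens _ yx.
have [e [e0 ey ez]] : exists e, [/\ opos e, ole e y & ole e z].
  case: (EM (olt z y)) => [zy'|/oleNgt yz]; first by exists z; split=> //; left.
  by exists y.
exists e; split=> //; rewrite mulrSr; apply: (@ole_lt_trans _ (y *+ n + z)).
  by apply: ole_add => //; rewrite !pmulrn; exact: ole_mulrz.
by rewrite -(olt_add2l (- (y *+ n))) addrA addNr add0r addrC.
Qed.

(** Take d positive with n d < y - x. The first multiple of n d beyond x exists by archimedeanity
    and falls before y. *)
Lemma archimedean_regular_dense :
  (forall x, opos x -> exists y, opos y /\ olt y x) -> regular_dense W.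
Proof.
move=> dens n x y n0 xy; have [d [d0 dxy]] := dense_small n dens xy.
have dn0 : opos (d *+ n) by exact: opos_mulrn.
have [k [k1 k2]] := arch_floor x dn0.
have E : d *~ (k + 1) *+ n = d *+ n *~ (k + 1) by zring.
exists (d *~ (k + 1)); rewrite E; split=> //.
rewrite mulrzDr mulr1z; apply: (@ole_lt_trans _ (x + d *+ n));
  first by rewrite ole_add2r.
by rewrite -(olt_add2l (- x)) addrA addNr add0r addrC.
Qed.
End Archimedean.

Section CArchimedean.
Variables (R : realType) (A : coGroup) (t : A -> R) (U : unwinding A).
Hypothesis t_angle : angle_map t.
Hypothesis t_cyc : forall a b c : A, cyc a b c <-> cyc3 (t a) (t b) (t c).

Lemma angle0 : t 0 = 0.
Proof.
have [t0 tD _] := t_angle; have := tD 0 0; have := t0 0; rewrite addr0 => h.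
by case=> e; lra.
Qed.

(** If every n x stayed below u, the angles would add without wrapping, so that t (n x) = n t (x)
    for the classes, and this would eventually exceed 2 pi. *)
Lemma angle_archimedean : archimedean U.
Proof.
have [t0 tD tI] := t_angle; have up := uu_pos U.
suff unit_arch (x : U) : opos x -> exists n, ole (uu U) (x *+ n).
  move=> x y x0; have [n hn] := unit_arch x x0; have [k [_ k2]] := ufloor y.
  have [m km] : exists m : nat, k + 1 <= m%:Z by exists `|(k + 1)%R|%N; lia.
  exists (n * m)%N; apply: olt_le_trans k2 _.
  apply: (@ole_trans _ (uu U *~ m)).
    have [->|ne] := eqVneq (k + 1) m; first exact: ole_refl.
    by left; apply/olt_mulrzr => //; lia.
  by rewrite mulrnA !pmulrn; exact: ole_mulrz.
move=> x0; apply: contrapT => hn.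
have xu n : olt (x *+ n) (uu U) by apply: contrapT => /oleNgt h; apply: hn; exists n.
have tx n : t (upr U x *+ n) = t (upr U x) *+ n.
  elim: n => [|n IH]; first by rewrite !mulr0n angle0.
  rewrite mulrSr mulrSr; case: (tD (upr U x *+ n) (upr U x)); rewrite IH // => e.
  case: n IH e => [|n] IH e.
    by move: e; rewrite !mulr0n !add0r; have := pi_gt0 R; lra.
  have := t0 (upr U x); rewrite -IH in e => htx.
  have : cyc 0 (upr U x *+ n.+1) (upr U x *+ n.+2).
    have ge0 m : ole 0 (x *+ m).
      by case: m => [|m]; [exact: ole_refl|left; rewrite olt0; exact: opos_mulrn].
    rewrite -!raddfMn -(raddf0 (upr U)); apply/upr_cyc => //.
      by rewrite olt0.
    by apply: Or31; split; [rewrite olt0; exact: opos_mulrn|exact: opos_le_mulrn].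
  have := t0 (upr U x *+ n.+1); have := t0 (upr U x *+ n.+2).
  rewrite [_ *+ n.+2]mulrSr e => h1 h2 /t_cyc; rewrite angle0 e.
  by case=> h; lra.
have txp : 0 < t (upr U x).
  rewrite lt_neqAle (andP (t0 _)).1 andbT; apply/eqP => h.
  have : upr U x = 0 by apply: tI; rewrite -h angle0.
  have := xu 1%N; rewrite mulr1n => xu1; rewrite -(raddf0 (upr U)).
  rewrite -olt0 in up.
  move/(upr_inj (or_introl _) xu1 (ole_refl _) up); rewrite olt0 => /(_ x0) e.
  by rewrite e in x0; exact: opos0 x0.
have b0 : 0 <= 2 * pi / t (upr U x).
  by apply: divr_ge0; [have := pi_gt0 R; lra|exact: ltW].
have := archi_boundP b0; set m := Num.bound _ => hm.
have := t0 (upr U x *+ m); rewrite tx -[t _ *+ m]mulr_natr => /andP[_].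
by move: hm; rewrite ltr_pdivrMr // mulrC; lra.
Qed.

(** With a least positive element d, archimedeanity gives W = Zd and u = m d, so that A would have
    at most |m| elements. *)
Lemma infinite_angle_regular : infinite_set [set: A] -> regular_dense U.
Proof.
move=> infA; apply: (archimedean_regular_dense angle_archimedean) => d d0.
apply: contrapT => nd; apply: infA.
have mult (x : U) : exists k, x = d *~ k.
  have [k [k1 k2]] := arch_floor angle_archimedean x d0; exists k.
  case: k1 => // k1; case: nd; exists (x - d *~ k); split=> //.
  by rewrite -(olt_add2r (d *~ k)) subrK; move: k2; rewrite mulrzDr mulr1z addrC.
have [m um] := mult (uu U).
have fin : finite_set [set k : nat | (k < `|m|)%N] by exact: finite_II.
apply: sub_finite_set (finite_image (fun k => upr U (d *+ k)) fin) => x _ /=.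
have [k hk] := mult (ulift U x).
have k0 : 0 <= k.
  have := ulift_ge0 U x; rewrite hk -(mulr0z d) oleNgt => h.
  by rewrite leNgt; apply/negP => lt; apply: h; apply/olt_mulrzr.
have km : k < m by apply/(olt_mulrzr _ _ d0); rewrite -hk -um; exact: ulift_lt.
exists `|k|%N => /=; first by lia.
by rewrite pmulrn gez0_abs // -hk uliftK.
Qed.
End CArchimedean.

(** * Circle models of dense c-regular groups *)

Lemma real_uncountable (R : realType) : ~ countable [set: R].
Proof.
move=> cR; have c01 : countable ([set` `[0, 1]] : set R) by exact: sub_countable
  (subset_card_le (@subsetT _ _)) cR.
have := countable_lebesgue_measure0 c01;
  rewrite lebesgue_measure_itv /= lte_fin ltr01 oppr0 adde0.
by move=> [] /eqP; rewrite oner_eq0.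
Qed.

(** * Realizing a countable family by real numbers *)

Section Embedding.
Variables (R : realType) (W : ogroup) (x : nat -> W).
Hypothesis x0 : opos (x 0%N).

Lemma real_transcendental n (th : nat -> R) :
  exists a, forall (k : int) c, k != 0 -> a *~ k <> lin n c th.
Proof.
apply: contrapT => h; apply: (@real_uncountable R).
pose F (p : int * seq int) : R := lin n (nth 0 p.2) th / p.1%:~R.
have cF := sub_countable (card_image_le F [set: int * seq int]) (countableP _).
apply: sub_countable cF.
apply: subset_card_le => a _.
have [k [c [k0 e]]] : exists k c, k != 0 /\ a *~ k = lin n c th.
  apply: contrapT => hn; apply: h; exists a => k c k0 e; apply: hn.
  by exists k, c.
exists (k, mkseq c n) => //; rewrite /F /=.
have -> : lin n (nth 0 (mkseq c n)) th = lin n c th.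
  by apply: lin_ext => // j jn; rewrite nth_mkseq.
by rewrite -e -mulrzr mulfK // intr_eq0.
Qed.

Let same_relations n (th : nat -> R) := forall c, lin n c x = 0 <-> lin n c th = 0.

(** A rational dependence of [x n] on its predecessors forces the value of a; without one, any real
    outside the rational span of the chosen values works, and that span is countable. *)
Lemma same_relations_extend n th : same_relations n th ->
  exists a, same_relations n.+1 [eta th with n |-> a].
Proof.
move=> hth.
case: (EM (exists (k : int) c, k != 0 /\ x n *~ k = lin n c x)) => [[k [c [k0 e]]]|h].
  pose a : R := lin n c th / k%:~R; exists a => d.
  have ea : a *~ k = lin n c th by rewrite /a -mulrzr divfK // intr_eq0.
  have e1 : lin n.+1 d x *~ k = lin n (fun j => d j * k + c j * d n) x.
    by rewrite linS linD !linZ -e; zring.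
  have e2 : lin n.+1 d [eta th with n |-> a] *~ k = lin n (fun j => d j * k + c j * d
    n) th.
    by rewrite lin_last linD !linZ -ea; zring.
  split=> h.
    have : lin n.+1 d [eta th with n |-> a] *~ k = 0.
      by rewrite e2; apply/hth; rewrite -e1 h mul0rz.
    by move/eqP; rewrite mulrz_eq0 (negbTE k0) => /eqP.
  apply: (otorsion_free k0); rewrite e1; apply/hth.
  by rewrite -e2 h mul0rz.
have [a ha] := real_transcendental n th; exists a => d; rewrite linS lin_last.
have [->|dn] := eqVneq (d n) 0; first by rewrite !mulr0z !addr0; exact: hth.
split=> e.
  case: h; exists (d n), (fun j => - d j); split=> //.
  by rewrite linN; apply/eqP; rewrite -addr_eq0 addrC e.
case: (ha (d n) (fun j => - d j) dn).
by rewrite linN; apply/eqP; rewrite -addr_eq0 addrC e.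
Qed.

Lemma same_relations_exist (a : R) : 0 < a ->
  exists th, th 0%N = a /\ forall n, same_relations n th.
Proof.
move=> a0.
have /choice [F hF] : forall p : nat * (nat -> R), exists b,
    same_relations p.1 p.2 -> same_relations p.1.+1 [eta p.2 with p.1 |-> b].
  move=> [n th] /=; case: (EM (same_relations n th)) => [/same_relations_extend [b
    hb]|h].
    by exists b.
  by exists 0.
(* Stage n modifies only index n, so the stages agree on the indices already treated and the
   sequence is their diagonal. *)
pose T := fix T n : nat -> R := if n is m.+1 then [eta T m with m.+1 |-> F (m.+1, T
  m)] else fun=> a.
have hT n : same_relations n.+1 (T n).
  elim: n => [|n IH]; last exact: (hF (n.+1, T n)).
  move=> c; rewrite /lin !big_ord1 /=; split=> e.
    have [->|c0] := eqVneq (c 0%N) 0; first by rewrite mulr0z.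
    by case: (@opos0 W); rewrite -(otorsion_free c0 e).
  by move/eqP: e; rewrite mulrz_eq0 (gt_eqF a0) orbF => /eqP->; rewrite mulr0z.
have TE n j : (j <= n)%N -> T n j = T j j.
  elim: n => [|n IH]; first by case: j.
  by rewrite leq_eqVlt => /orP[/eqP->//|jn] /=; rewrite ltn_eqF // IH.
exists (fun j => T j j); split=> // -[|n].
  by move=> c; rewrite !lin0.
move=> c; rewrite (hT n c);
  suff -> : lin n.+1 c (T n) = lin n.+1 c (fun j => T j j) by [].
by apply: lin_ext => // j jn; rewrite TE.
Qed.

Variable th : nat -> R.
Hypothesis hth : forall n, same_relations n th.

(* The graph of an isomorphism from a pure subgroup of W to a subgroup of R. *)
Definition matched (w : W) (a : R) := exists (k n : nat) c,
  [/\ (0 < k)%N, w *+ k = lin n c x & a *+ k = lin n c th].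

Lemma lin_pad (A : zmodType) n N c (g : nat -> A) : (n <= N)%N ->
  lin n c g = lin N (fun j => if (j < n)%N then c j else 0) g.
Proof.
move=> nN; rewrite /lin (big_ord_widen _ (fun j => g j *~ c j) nN) big_mkcond.
by apply: eq_bigr => j _; case: ifP.
Qed.

Lemma matchedD v w a b : matched v a -> matched w b -> matched (v + w) (a + b).
Proof.
move=> [k [n [c [k0 h1 h2]]]] [l [m [d [l0 h3 h4]]]].
exists (k * l)%N, (maxn n m), (fun j => (if (j < n)%N then c j else 0) * l%:Z
  + (if (j < m)%N then d j else 0) * k%:Z).
rewrite muln_gt0 k0 l0 !linD !linZ -!(lin_pad _ _ (leq_maxl n m)) -!(lin_pad _ _
  (leq_maxr n m)).
by rewrite -h1 -h2 -h3 -h4; split=> //; zring.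
Qed.

Lemma matchedN w a : matched w a -> matched (- w) (- a).
Proof.
move=> [k [n [c [k0 h1 h2]]]]; exists k, n, (fun j => - c j).
by rewrite !linN -h1 -h2 !mulNrn.
Qed.

Lemma matched_gen i : matched (x i) (th i).
Proof.
exists 1%N, i.+1, (fun j => if j == i then 1 else 0).
by rewrite !lin_delta // !mulr1z !mulr1n.
Qed.

Lemma matchedM w a (k : int) : matched w a -> matched (w *~ k) (a *~ k).
Proof.
move=> [m [n [c [m0 h1 h2]]]]; exists m, n, (fun j => c j * k).
by rewrite !linZ -h1 -h2; split=> //; zring.
Qed.

Lemma matched0 w a : matched w a -> w = 0 <-> a = 0.
Proof.
move=> [k [n [c [k0 h1 h2]]]]; have kz : k%:Z != 0 by lia.
split=> e.
  have /eqP : a *+ k = 0 by rewrite h2; apply/hth; rewrite -h1 e mul0rn.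
  by rewrite mulrn_eq0 (gtn_eqF k0) => /eqP.
by apply: (otorsion_free kz); rewrite -pmulrn h1; apply/hth; rewrite -h2 e mul0rn.
Qed.

Lemma matched_pure w a m : (0 < m)%N -> matched (w *+ m) a -> matched w (a / m%:R).
Proof.
move=> m0 [k [n [c [k0 h1 h2]]]]; exists (m * k)%N, n, c; split=> //.
- by rewrite muln_gt0 m0.
- by rewrite mulrnA.
- by rewrite mulrnA -[_ *+ m]mulr_natr divfK // pnatr_eq0 -lt0n.
Qed.
End Embedding.

Lemma angle_map_c_archimedean (R : realType) (A : zmodType) (t : A -> R)
    (ht : angle_map t) :
  c_archimedean R (CoGroup (angle_map_cyclic_order ht)).
Proof.
have [t0 tD tI] := ht; exists (range (fun a => expi (t a))), (fun a => expi (t a)).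
have pi0 := pi_gt0 R.
have eD x y : expi (t (x + y)) = expi (t x) * expi (t y).
  rewrite -expiD; case: (tD x y) => -> //.
  by rewrite expiD expiN expi2pi invr1 mulr1.
have e1 : expi (t 0) = 1.
  suff -> : t 0 = 0 by exact: expi0.
  by have := tD 0 0; have := t0 0; rewrite addr0 => h; case=> e; lra.
split.
- split=> [z [a _ <-]||z w [a _ <-] [b _ <-]|z [a _ <-]].
  + exact: expi_norm.
  + by exists 0.
  + by exists (a + b); rewrite ?eD.
  + exists (- a) => //; apply: (mulfI (x := expi (t a))).
      by apply/eqP => e; have := expi_norm (t a); rewrite e normr0 => /eqP;
        rewrite eq_sym oner_eq0.
    rewrite -eD subrr e1 mulfV //.
    by apply/eqP => e; have := expi_norm (t a); rewrite e normr0 => /eqP;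
      rewrite eq_sym oner_eq0.
- split=> [a _|a b _ _ /expi_inj e|_ [a _ <-]]; first by exists a.
    by apply: tI; exact: e.
  by exists a.
- exact: eD.
by move=> a b c /=; rewrite circle_cyc_expi.
Qed.

(** The unit u is sent to 2 pi, so the isomorphism [matched] descends to classes modulo u and modulo
    2 pi. Purity holds because a real matched with m w can be divided by m. *)
Lemma circle_embedding (R : realType) (G : coGroup) (U : unwinding G) (x : nat -> U) :
  x 0%N = uu U -> exists (A : coGroup) (v : A -> G),
  [/\ c_archimedean R A, injective v, {morph v : a b / a + b}
    & (forall i, exists a, v a = upr U (x i)) /\
      (forall m g, (0 < m)%N -> (exists a, v a = g *+ m) -> exists a, v a = g)].
Proof.
move=> xu; have up := uu_pos U; have pi0 := pi_gt0 R.
have pi2 : 0 < 2 * pi :> R by lra.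
have [|th [th0 hth]] := @same_relations_exist R U x _ _ pi2; first by rewrite xu.
pose M := matched x th; have Mu : M (uu U) (2 * pi).
  by rewrite -xu -th0; exact: matched_gen.
have M0 : M 0 0 by have := matchedM 0 Mu; rewrite !mulr0z.
pose P (g : G) := exists (w : U) (a : R), [/\ M w a, upr U w = g & 0 <= a < 2 * pi].
have PI w a : M w a -> P (upr U w).
  move=> Mwa; pose k : int := Num.floor (a / (2 * pi)).
  exists (w - uu U *~ k), (a - 2 * pi *~ k); split.
  - by apply: matchedD => //; apply: matchedN; exact: matchedM.
  - by rewrite raddfB upr_uM subr0.
  have := floor_itv (a / (2 * pi)); rewrite -/k intrD => /andP[].
  rewrite ler_pdivlMr // ltr_pdivrMr // -mulrzr => h1 h2.
  by apply/andP; split; lra.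
have P0 : P 0 by rewrite -(raddf0 (upr U)); exact: PI M0.
have PD g h : P g -> P h -> P (g + h).
  move=> [w [a [h1 <- _]]] [w' [a' [h2 <- _]]].
  by rewrite -raddfD; exact: PI (matchedD h1 h2).
have PN g : P g -> P (- g).
  move=> [w [a [h1 <- _]]].
  by rewrite -raddfN; exact: PI (matchedN h1).
pose T := {g : G | `[< P g >]}.
pose zero : T := exist _ 0 (asboolT P0).
pose opp (g : T) : T := exist _ (- sval g) (asboolT (PN _ (asboolW (svalP g)))).
pose add (g h : T) : T := exist _ (sval g + sval h) (asboolT (PD _ _ (asboolW (svalP
  g)) (asboolW (svalP h)))).
have addA : associative add by move=> a b c; apply: val_inj; exact: addrA.
have addC : commutative add by move=> a b; apply: val_inj; exact: addrC.
have add0 : left_id zero add by move=> a; apply: val_inj; exact: add0r.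
have addN : left_inverse zero opp add by move=> a; apply: val_inj; exact: addNr.
pose B : zmodType := HB.pack T (GRing.isZmodule.Build T addA addC add0 addN).
have /choice [t ht] : forall g : B, exists a : R, exists w, [/\ M w a, upr U w = val
  g & 0 <= a < 2 * pi].
  by move=> g; have [w [a h]] := asboolW (svalP g); exists a, w.
(* The real attached to a class is determined modulo 2 pi, hence unique in [0, 2 pi[; for a sum of
   two angles the number of turns can only be 0 or -1. *)
have uniq w w' a a' : M w a -> M w' a' -> upr U w = upr U w' -> exists k : int, a =
  a' + 2 * pi *~ k.
  move=> h1 h2 /upr_eq [k hk]; exists k.
  have := matchedD (matchedD h1 (matchedN h2)) (matchedN (matchedM k Mu)).
  rewrite hk; have -> : w' + uu U *~ k - w' - uu U *~ k = 0 by zring.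
  by move=> /(matched0 hth) [/(_ erefl) e _]; lra.
have tA : angle_map t.
  split=> [g|g h|g h e]; first by have [w []] := ht g.
    have [w [m1 u1 r1]] := ht g; have [w' [m2 u2 r2]] := ht h;
      have [w3 [m3 u3 r3]] := ht (g + h).
    have [|k] := uniq _ _ _ _ m3 (matchedD m1 m2); first by rewrite raddfD /= u1 u2 u3.
    rewrite -mulrzr => e.
    have [k0|k0] := ltP (-1) k.
      have [k1|k1] := ltP k 1; first by left; have k00 : k = 0 by [lia];
        rewrite e k00 mulr0 addr0.
      have : (1 : R) <= k%:~R by rewrite ler1z; lia.
      by nra.
    have [k1|k1] := ltP (-2) k.
      right; have k00 : k = -1 by lia.
      by rewrite e k00 mulrN1.
    have : k%:~R <= (-2%:~R : R) by rewrite -mulrNz ler_int.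
    by nra.
  have [w [m1 u1 r1]] := ht g; have [w' [m2 u2 r2]] := ht h.
  apply: val_inj; rewrite -[LHS]u1 -[RHS]u2; congr (upr U _).
  have := matchedD m1 (matchedN m2);
    rewrite e subrr => /(matched0 hth) [_ /(_ erefl)] /eqP.
  by rewrite subr_eq0 => /eqP.
exists (CoGroup (angle_map_cyclic_order tA)), (fun a => val (a : B)).
split=> //; first exact: angle_map_c_archimedean.
split=> [i|m g m0 [a /= ea]].
  have Pi : P (upr U (x i)) by exact: PI (matched_gen _ _ i).
  by exists (exist (fun g => `[< P g >]) _ (asboolT Pi)).
suff Pg : P g by exists (exist (fun g => `[< P g >]) _ (asboolT Pg)).
have [w [b [Mw uw _]]] := asboolW (svalP a).
have [k hk] : exists k, ulift U g *+ m = w + uu U *~ k.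
  by apply: upr_eq; rewrite raddfMn /= uliftK uw.
have Mg : M (ulift U g *+ m) (b + 2 * pi *~ k).
  by rewrite hk; apply: matchedD => //; exact: matchedM.
by rewrite -(uliftK U g); exact: PI (matched_pure m0 Mg).
Qed.

Lemma infinite_c_archimedean_regular (R : realType) (A : coGroup) :
  infinite_set [set: A] -> c_archimedean R A -> regular_dense (unwound_unwinding A).
Proof. by move=> iA /c_archimedean_angle [t [t1 t2]];
  exact: infinite_angle_regular t1 t2 iA. Qed.

(** Any subgroup containing these elements is infinite, by a strictly decreasing sequence in ]0, u[,
    and contains an incongruent family of each size that G admits for p. *)
Lemma witness_sequence (G : coGroup) (U : unwinding G) : co_dense G -> exists x : nat
  -> U,
  [/\ x 0%N = uu U,
      exists h : nat -> G, injective h /\ forall k, exists i, upr U (x i) = h k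
    & forall p n, incongruent_family G p n -> exists v : 'I_n -> G,
        (forall i j, i != j -> ~ congruent p (v i) (v j)) /\
        forall j, exists i, upr U (x i) = v j].
Proof.
move=> dG.
have /choice [F hF] : forall w : U, exists z, opos w -> opos z /\ olt z w.
  move=> w; case: (EM (opos w)) => [pw|nw]; last by exists 0.
  have [|z [z0 zw]] := co_dense_order dG (v := 0) (w := w); first by rewrite olt0.
  by exists z => _; split=> //; rewrite -olt0.
pose h k := iter k.+1 F (uu U).
have h0 k : opos (iter k F (uu U)).
  by elim: k => [|k IH] /=; [exact: uu_pos|have [] := hF _ IH].
have hS k : olt (h k.+1) (h k) by exact: (hF _ (h0 _)).2.
have hu k : olt (h k) (uu U).
  elim: k => [|k IH]; first exact: (hF _ (h0 0%N)).2.
  exact: olt_trans (hS k) IH.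
have hlt j k : (j < k)%N -> olt (h k) (h j).
  elim: k => // k IH; rewrite ltnS leq_eqVlt => /orP[/eqP->|/IH]; first exact: hS.
  by move=> jk; exact: olt_trans (hS k) jk.
have hinj : injective (upr U \o h).
  move=> j k /= /(upr_inj _ (hu j) _ (hu k)) => e.
  have {}e : h j = h k by apply: e; left; rewrite olt0; exact: h0.
  have [jk|jk|//] := ltngtP j k.
    by have := hlt _ _ jk; rewrite e => /olt_irr.
  by have := hlt _ _ jk; rewrite e => /olt_irr.
have /choice [wit hwit] : forall q : nat * nat, exists v : nat -> G,
    incongruent_family G q.1 q.2 -> forall i j : 'I_q.2, i != j -> ~ congruent q.1 (v
      i) (v j).
  move=> [p n] /=; case: (EM (incongruent_family G p n)) => [[v hv]|nv];
    last by exists (fun=> 0).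
  by exists (fun i => oapp v 0 (insub i)) => _ i j ij; rewrite !valK; exact: hv.
pose val_at (s : nat + (nat * nat) * nat) : U := match s with
  | inl k => h k
  | inr (q, i) => ulift U (wit q i)
  end.
(* Index 0 is reserved for u, which must go to 2 pi; numbers that code nothing yield 0. *)
exists (fun n => if n is m.+1 then oapp val_at 0 (choice.unpickle m) else uu U);
  split=> //.
  exists (upr U \o h); split=> // k;
    exists (choice.pickle (inl k : nat + (nat * nat) * nat)).+1.
  by rewrite choice.pickleK.
move=> p n pn; exists (fun i => wit (p, n) i); split; first exact: (hwit (p, n) pn).
move=> j; exists (choice.pickle (inr ((p, n), val j) : nat + (nat * nat) * nat)).+1.
by rewrite choice.pickleK /= uliftK.
Qed.

(** Purity makes congruence modulo p in A and in G agree, and puts every torsion element of G into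
    A, since 0 = m g lies there. The chosen witnesses then provide the incongruent families of G in
    A. *)
Lemma c_archimedean_model (R : realType) (G : coGroup) : c_regular G -> co_dense G ->
  exists A : coGroup, [/\ infinite_set [set: A], c_archimedean R A & elem_equiv A G].
Proof.
move=> rG dG; pose U := unwound_unwinding G.
have [x [x0 [h [hinj hx]] inc]] := witness_sequence U dG.
have [A [v [cA vinj vD [vx vpure]]]] := circle_embedding R x0.
have v0 : v 0 = 0 by apply: (addrI (v 0)); rewrite -vD !addr0.
have vN a : v (- a) = - v a by apply: (addrI (v a)); rewrite -vD !subrr.
have vM a n : v (a *+ n) = v a *+ n.
  by elim: n => [|n IH]; rewrite ?mulr0n // !mulrS vD IH.
have iA : infinite_set [set: A].
  have /choice [g hg] : forall k, exists a, v a = h k.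
    by move=> k; have [i <-] := hx k; exact: vx.
  have ginj : injective g by move=> j k e; apply: hinj; rewrite -!hg e.
  move=> fin; apply: infinite_nat.
  by have := finite_preimage (f := g) (fun j k _ _ => ginj j k) fin;
    rewrite preimage_setT.
exists A; split=> //; have rA := infinite_c_archimedean_regular iA cA.
apply: (same_invariants_elem_equiv rA (c_regular_regular (U := U) dG rG)).
split=> [p n pp|m m0].
  have vcong a b : congruent p (v a) (v b) <-> congruent p a b.
    split=> -[z hz]; last by exists (v z); rewrite -vM -hz vD vN.
    have [c hc] : exists c, v c = z.
      by apply: (vpure p) => //; [exact: prime_gt0|exists (a - b); rewrite vD vN].
    by exists c; apply: vinj; rewrite vD vN vM hc.
  split=> [[u hu]|/inc [u [hu ux]]].
    by exists (v \o u) => i j /hu; rewrite /= vcong.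
  have /choice [g hg] : forall j, exists a, v a = u j.
    by move=> j; have [i <-] := ux j; exact: vx.
  by exists g => i j /hu; rewrite -!hg vcong.
rewrite -!has_order_divides //; split=> [[a [am ak]]|[g [gm gk]]].
  exists (v a); rewrite -vM am v0; split=> // k km k0; rewrite -vM -v0 => /vinj.
  exact: ak.
have [a ha] : exists a, v a = g.
  by apply: (vpure m) => //; exists 0; rewrite v0 gm.
exists a; split=> [|k km k0 e]; first by apply: vinj; rewrite vM ha v0.
by apply: (gk k km k0); rewrite -ha -vM e v0.
Qed.

Theorem theorem4p12 (R : realType) :
  (forall G : coGroup,
     (exists A : coGroup,
        [/\ infinite_set [set: A]%classic, c_archimedean R A
          & elem_equiv A G])
     <-> (c_regular G /\ co_dense G)) /\
  (forall G H : coGroup,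
     co_dense G -> c_regular G -> co_dense H -> c_regular H ->
     (elem_equiv G H <->
        (torsion_isomorphic G H /\
         (forall p : nat, prime p ->
            zakon_invariant G p = zakon_invariant H p)))).
Proof.
split=> [G|G H dG rG dH rH].
  split=> [[A [iA cA AG]]|[rG dG]]; last exact: c_archimedean_model.
  have rA := infinite_c_archimedean_regular iA cA; split.
    exact: elem_equiv_c_regular AG (regular_c_regular rA).
  exact: elem_equiv_co_dense AG (regular_co_dense rA).
pose U := unwound_unwinding G; pose V := unwound_unwinding H.
split=> [GH|[tGH zGH]].
  split=> [|p _].
    apply: (divides_torsion_iso (U := U) (V := V)) => m m0.
    by rewrite -!has_order_divides //; exact: elem_equiv_has_order.
  by apply/zakon_incongruent => n; exact: elem_equiv_incongruent.
apply: (same_invariants_elem_equiv (c_regular_regular (U := U) dG rG)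
  (c_regular_regular (U := V) dH rH)).
split=> [p m pp|m m0]; first exact: (zakon_incongruent G H p).1 (zGH p pp) m.
by rewrite -!has_order_divides //; exact: torsion_iso_has_order.
Qed.
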